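(* Let $\mathcal{X}$, $\mu$, $\nu$, $\mathcal{P}$, $\mathcal{B}_+(\mathcal{X})$ and $\zeta$ be as in the context. Let $\phi:\mathcal{X}\to\mathcal{X}$ be a measurable bijection such that for some constant $c>0$, $\mu(\phi^{-1}(A))=c\,\mu(A)$ for all $A\in\mathcal{B}_+(\mathcal{X})$. Then the set-indexed processes $(\zeta(\phi(A)))_{A\in\mathcal{B}_+(\mathcal{X})}$ and $(\zeta(A))_{A\in\mathcal{B}_+(\mathcal{X})}$ have the same finite-dimensional distributions.
   Context: Let $\mathcal{G}$ be the space of Lipschitz functions $f:\mathbb{R}\to\mathbb{R}$ with the norm $|f(0)|+L_f$, where $L_f=\sup_{x\neq y}|f(y)-f(x)|/|x-y|$, and its Borel $\sigma$-algebra. Let $\nu$ be a probability measure on $\mathcal{G}$, $f$ a random element with distribution $\nu$, and assume $\mathbf{E}L_f<\infty$, $\mathbf{E}\log L_f<0$ and $\mathbf{E}|f(z_0)-z_0|<\infty$ for a fixed $z_0\in\mathbb{R}$. Let $\mathcal{X}$ be a complete separable metric space with a $\sigma$-finite measure $\mu$, and $\mathcal{B}_+(\mathcal{X})$ the family of Borel sets $A$ with $\mu(A)\in(0,\infty)$. Let $\mathcal{P}$ be a Poisson process on $[0,\infty)\times\mathcal{X}\times\mathcal{G}$ with intensity $\mathrm{Leb}\otimes\mu\otimes\nu$. For $A\in\mathcal{B}_+(\mathcal{X})$, enumerate the points $(t_{k,A},x_{k,A},f_{k,A})$ of $\mathcal{P}$ with $x_{k,A}\in A$ so that $t_{1,A}<t_{2,A}<\cdots$,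 let $N_A(t)$ be the number of them with $t_{k,A}\le t$, and $\zeta_t(A)=f_{1,A}\circ\cdots\circ f_{N_A(t),A}(z_0)$. The a.s. limit $\zeta(A)=\lim_{t\to\infty}\zeta_t(A)$ exists and does not depend on $z_0$. *)

(* Defs.v *)
From HB Require Import structures.
From mathcomp Require Import all_boot all_order all_algebra.
From mathcomp Require Import all_classical all_reals all_analysis.
Set Implicit Arguments. Unset Strict Implicit. Unset Printing Implicit Defensive.
Import Order.TTheory GRing.Theory Num.Theory.
Import numFieldNormedType.Exports.
Local Open Scope classical_set_scope.
Local Open Scope ring_scope.

Section metric.
Context {R : realType} {T : Type}.
Variable dist : T -> T -> R.

Definition is_metric :=
  [/\ forall x y, 0 <= dist x y,
      forall x y, dist x y = 0 <-> x = y,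
      forall x y, dist x y = dist y x &
      forall x y z, dist x z <= dist x y + dist y z].

Definition metric_open (U : set T) :=
  forall x, U x -> exists e : R, 0 < e /\ [set y | dist x y < e] `<=` U.

Definition metric_complete :=
  forall u : nat -> T,
    (forall e : R, 0 < e -> exists N, forall m n, (N <= m)%N -> (N <= n)%N ->
        dist (u m) (u n) < e) ->
    exists l, forall e : R, 0 < e -> exists N, forall n, (N <= n)%N -> dist (u n) l < e.

Definition metric_separable :=
  exists D : set T, countable D /\
    forall x (e : R), 0 < e -> exists2 y, D y & dist x y < e.
End metric.

Definition metric_borel {R : realType} d (T : measurableType d) (dist : T -> T -> R) :=
  (@measurable d T) = <<s metric_open dist >>.

Definition lipschitzR {R : realType} (f : R -> R) :=
  exists L : R, forall x y, `|f y - f x| <= L * `|x - y|.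

Record Lip (R : realType) := MkLip { lip_fun :> R -> R ; lip_prop : lipschitzR lip_fun }.

Section lip_instances.
Context {R : realType}.
Lemma lipschitzR0 : lipschitzR (fun _ : R => 0).
Proof. by exists 0 => x y; rewrite subrr normr0 mul0r. Qed.
HB.instance Definition _ := gen_eqMixin (Lip R).
HB.instance Definition _ := gen_choiceMixin (Lip R).
HB.instance Definition _ := isPointed.Build (Lip R) (MkLip lipschitzR0).

Definition lipconst (f : R -> R) : R :=
  sup [set r | exists x y, x != y /\ r = `|f y - f x| / `|x - y|].

Definition lipdist (f g : Lip R) : R :=
  `|f 0 - g 0| + lipconst (fun x => f x - g x).
End lip_instances.

Definition Gsp (R : realType) := g_sigma_algebraType (@metric_open R (Lip R) lipdist).

Definition logL {R : realType} (f : Lip R) : \bar R :=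
  if lipconst f == 0 then -oo%E else (ln (lipconst f))%:E.

Definition poisson_weight {R : realType} (r : R) (k : nat) : R :=
  r ^+ k / (k`!)%:R * expR (- r).

Section poisson.
Context {R : realType} dO (O : measurableType dO) dS (S : measurableType dS).

Definition count_eq (Pts : O -> set S) (B : set S) (k : nat) : set O :=
  [set w | exists e : 'I_k -> S, injective e /\ Pts w `&` B = range e].

Definition is_poisson_process (P : probability O R) (Pts : O -> set S)
    (lambda : set S -> \bar R) :=
  (forall B k, measurable B -> measurable (count_eq Pts B k)) /\
  (forall n (B : 'I_n -> set S) (k : 'I_n -> nat),
     (forall i, measurable (B i)) -> (forall i, (lambda (B i) < +oo)%E) ->
     (forall i j, i != j -> B i `&` B j = set0) ->
     P (\bigcap_(i in [set: 'I_n]) count_eq Pts (B i) (k i)) =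
     (\prod_(i < n) poisson_weight (fine (lambda (B i))) (k i))%:E).
End poisson.

Lemma measurable_Rpos (R : realType) : measurable (`[0%R, +oo[ : set R).
Proof. exact: measurable_itv. Qed.

Definition intensity {R : realType} d (X : measurableType d)
  (mu : set X -> \bar R) (nu : set (Gsp R) -> \bar R) : set (R * (X * Gsp R)) -> \bar R :=
  product_measure1 (mrestr (@lebesgue_measure R) (@measurable_Rpos R))
                   (product_measure1 mu nu).

Definition Bplus {R : realType} d (X : measurableType d) (mu : set X -> \bar R) (A : set X) :=
  measurable A /\ (0 < mu A < +oo)%E.

Section zeta.
Context {R : realType} d (X : measurableType d) dO (O : measurableType dO).
Variables (z0 : R) (Pts : O -> set (R * (X * Gsp R))).

Definition window (A : set X) (t : R) (w : O) : set (R * (X * Gsp R)) :=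
  Pts w `&` [set p | 0 <= p.1 <= t /\ A p.2.1].

(* zeta_t(A) = f_{1,A} o ... o f_{N_A(t),A} (z0), the points being listed by
   increasing times (z0 if the window is not a finite set with distinct times,
   an event of probability zero) *)
Definition zeta_t (A : set X) (t : R) (w : O) : R :=
  xget z0 [set z | exists s : seq (R * (X * Gsp R)),
    [/\ sorted (fun p q => p.1 < q.1) s,
        (forall p, window A t w p <-> p \in s) &
        z = foldr (fun p acc => lip_fun p.2.2 acc) z0 s]].

Definition zeta (A : set X) (w : O) : R := lim (zeta_t A t w @[t --> +oo]).
End zeta.

(* Main.v *)
Require Import Defs.
From HB Require Import structures.
From mathcomp Require Import all_boot all_order all_algebra.
From mathcomp Require Import all_classical all_reals all_analysis.
From mathcomp Require Import measurable_realfun lra.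
Set Implicit Arguments. Unset Strict Implicit. Unset Printing Implicit Defensive.
Import Order.TTheory GRing.Theory Num.Theory.
Import numFieldNormedType.Exports.
Local Open Scope classical_set_scope.
Local Open Scope ring_scope.

(* Let [rescale] send a point (t, x, f) to (t / c, phi^-1 x, f). Since
   mu (phi^-1 A) = c mu A, it preserves the intensity Leb (x) mu (x) nu, so the
   image of the Poisson process under [rescale] is a Poisson process with the
   same intensity. It preserves the order of the times, and t -> oo iff
   t / c -> oo, so zeta (phi A) is, for every outcome, the value of zeta A on
   the rescaled process. Two Poisson processes with the same intensity have the
   same law on the sigma-algebra generated by the counts of sets of finite
   intensity, and zeta A is measurable for it. No almost sure statement is
   used: zeta is measurable everywhere, including where its limit does not
   exist. That phi A is measurable is the Lusin-Souslin theorem. *)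

(** * The Lusin-Souslin theorem for bijections *)

(** Measurability of phi controls preimages under phi, whereas [rescale] moves points by its inverse
    g, whose preimages are images under phi; this is where Lusin-Souslin enters. That theorem comes
    from separation: disjoint measurable sets have images that a measurable set separates, and for a
    bijection the images of A and of its complement fill the target, so the separating set can only
    be the image of A. The factor 1 / c on times is forced: phi^-1 (g^-1 B) = B gives mu (g^-1 B) =
    mu B / c, and preimages under t -> t / c gain a factor c. Equality of laws is used on the
    canonical space: [zeta] is shown measurable for the identity process on [config], and both point
    processes are maps into [config] with the same law. *)

Lemma divSn_lt {R : realType} (K r : R) : 0 < r -> exists n : nat, K / n.+1%:R < r.
Proof.
move=> r0; exists (Num.truncn (K / r)); rewrite ltr_pdivrMr// -ltr_pdivrMl// mulrC.
exact: truncnS_gt.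
Qed.

Section covers.
Context {R : realType} {T : Type}.
Implicit Types (U : nat -> nat -> set T) (e : T -> T -> R) (x : nat -> nat).

(* The [n]-th cover of [core U] is [U n]; a branch is a choice [x] of one member
   of each cover. Complete and fine covers parametrise [core U] by the branches
   whose finite intersections are nonempty, i.e. by a closed subset of the Baire
   space, with no need to refine the topology as one usually does. *)
Definition core U : set T := [set a | forall n, exists m, U n m a].

Definition meets_along U x (s : seq nat) : set T :=
  [set a | forall k, k \in s -> U k (x k) a].

Definition complete_covers U :=
  forall x, (forall s, meets_along U x s !=set0) ->
  exists a, forall k, U k (x k) a.

(** Stated for one radius and for an arbitrary [e]: the pullback of a second metric will be
    controlled by a different cover at each radius. *)
Definition fine_at e (r : R) U := forall x,
  exists s, forall a b, meets_along U x s a -> meets_along U x s b -> e a b < r.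

Definition fine_covers e U := forall r : R, 0 < r -> fine_at e r U.

Definition unpair (k : nat) : nat * nat := odflt (0, 0)%N (unpickle k).

Lemma unpairK p : unpair (pickle p) = p.
Proof. by rewrite /unpair pickleK. Qed.

(** Interleaves countably many families of covers, to represent an intersection: a branch of the
    join is one branch of each [U i]. An index that codes no pair imposes nothing. *)
Definition join_covers (U : nat -> nat -> nat -> set T) : nat -> nat -> set T :=
  fun k => if pickle_inv k is Some p then U p.1 p.2 else fun=> setT.

Lemma join_pickle (U : nat -> nat -> nat -> set T) (p : nat * nat) :
  join_covers U (pickle p) = U p.1 p.2.
Proof. by rewrite /join_covers pickleK_inv. Qed.

Lemma core_join (U : nat -> nat -> nat -> set T) :
  core (join_covers U) = \bigcap_i core (U i).
Proof.
apply/seteqP; split => [a aU i _ n|a aU k].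
  by have := aU (pickle (i, n)); rewrite join_pickle.
rewrite /join_covers; case: pickle_inv => [p|]; first exact: aU.
by exists 0%N.
Qed.

Lemma join_meets (U : nat -> nat -> nat -> set T) x i s a :
  meets_along (join_covers U) x [seq pickle (i, n) | n <- s] a ->
  meets_along (U i) (fun n => x (pickle (i, n))) s a.
Proof.
move=> ha n ns; have := ha (pickle (i, n)).
by rewrite join_pickle; apply; apply/map_f.
Qed.

Lemma fine_join e (r : R) (U : nat -> nat -> nat -> set T) i :
  fine_at e r (U i) -> fine_at e r (join_covers U).
Proof.
move=> fU x; have [s hs] := fU (fun n => x (pickle (i, n))).
exists [seq pickle (i, n) | n <- s] => a b /join_meets ha /join_meets hb.
exact: hs.
Qed.

(* Each [U i] yields a limit point along its own subsequence; two of these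
   limits are at distance 0 since both covers are fine. *)
Lemma complete_join e (U : nat -> nat -> nat -> set T) :
  is_metric e ->
  (forall i, complete_covers (U i)) -> (forall i, fine_covers e (U i)) ->
  complete_covers (join_covers U).
Proof.
move=> [e0 eE eC eT] cU fU x hx.
have /choice[a ha] : forall i, exists a, forall n, U i n (x (pickle (i, n))) a.
  move=> i; apply: (cU i (fun n => x (pickle (i, n)))) => s.
  have [a /join_meets ?] := hx [seq pickle (i, n) | n <- s].
  by exists a.
have aE i : a i = a 0%N.
  apply/eE/eqP; rewrite eq_le e0 andbT leNgt; apply/negP => r0.
  set r := e (a i) (a 0%N) in r0.
  have r2 : 0 < r / 2 by rewrite divr_gt0.
  have [s hs] := fU i _ r2 (fun n => x (pickle (i, n))).
  have [t ht] := fU 0%N _ r2 (fun n => x (pickle (0%N, n))).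
  (* A point common to both finite stages is within r / 2 of each limit, although the limits are at
     distance r. *)
  have [b hb] := hx ([seq pickle (i, n) | n <- s] ++ [seq pickle (0%N, n) | n <- t]).
  have h1 : e (a i) b < r / 2.
    apply: hs => [n _|]; first exact: ha.
    by apply: join_meets => k ks; apply: hb; rewrite mem_cat ks.
  have h2 : e b (a 0%N) < r / 2.
    apply: ht => [|n _]; last exact: ha.
    by apply: join_meets => k ks; apply: hb; rewrite mem_cat ks orbT.
  have := eT (a i) b (a 0%N); rewrite -/r; lra.
exists (a 0%N) => k; rewrite /join_covers.
case E : (pickle_inv k) => [p|//].
have kE : k = pickle p by have := pickle_invK (T := (nat * nat)%type) k; rewrite E.
by rewrite -(aE p.1) kE; case: p {E kE} => i n; exact: ha.
Qed.

(** Stage 0 selects a piece and every later stage names a piece again; as the pieces are disjoint, a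
    branch with nonempty finite stages always names the same one and is a branch of its covers. *)
Definition union_covers (A : nat -> set T) (U : nat -> nat -> nat -> set T) :
    nat -> nat -> set T :=
  fun n k => if n is m.+1 then A (unpair k).1 `&` U (unpair k).1 m (unpair k).2
             else A k.

Section union.
Variables (A : nat -> set T) (U : nat -> nat -> nat -> set T).
Hypotheses (tA : trivIset setT A) (UA : forall i, core (U i) = A i).

Lemma core_union : core (union_covers A U) = \bigcup_i A i.
Proof.
apply/seteqP; split => [a /(_ 0%N)[i Aia]|a [i _ Aia] [|n]]; try by exists i.
have := Aia; rewrite -UA => /(_ n)[m Ua].
by exists (pickle (i, m)); rewrite /= unpairK.
Qed.

Lemma union_meets x n s a :
  meets_along (union_covers A U) x [:: 0%N, n.+1 & s] a ->
  (unpair (x n.+1)).1 = x 0%N.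
Proof.
move=> ha; have A0 := ha 0%N (mem_head _ _).
have [|An _] := ha n.+1; first by rewrite !inE eqxx orbT.
by apply: (tA (Logic.I) Logic.I); exists a; split.
Qed.

Lemma complete_union : (forall i, complete_covers (U i)) ->
  complete_covers (union_covers A U).
Proof.
move=> cU x hx; pose i := x 0%N.
have xi n : (unpair (x n.+1)).1 = i by have [a /union_meets] := hx [:: 0%N; n.+1].
have [|a ha] := cU i (fun n => (unpair (x n.+1)).2).
  move=> s; have [a ha] := hx [seq n.+1 | n <- s].
  by exists a => n ns; have [] := ha n.+1 (map_f _ ns); rewrite xi.
have Aa : A i a by rewrite -UA => n; exists (unpair (x n.+1)).2.
by exists a => -[|n] //=; rewrite xi.
Qed.

Lemma fine_union e (r : R) : (forall i, fine_at e r (U i)) ->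
  fine_at e r (union_covers A U).
Proof.
move=> fU x; have [xi|/existsNP[n xn]] :=
    pselect (forall n, (unpair (x n.+1)).1 = x 0%N); last first.
  (* A branch that changes piece is already empty at these two stages, so it is vacuously fine. *)
  by exists [:: 0%N; n.+1] => a b /union_meets.
have [s hs] := fU (x 0%N) (fun n => (unpair (x n.+1)).2).
exists [seq n.+1 | n <- s] => a b ha hb; apply: hs => n ns.
  by have [] := ha n.+1 (map_f _ ns); rewrite xi.
by have [] := hb n.+1 (map_f _ ns); rewrite xi.
Qed.

End union.

(** * Sieves of the Borel sets of a Polish space *)

Section polish.
Variable e : T -> T -> R.
Hypotheses (he : is_metric e) (hcompl : metric_complete e).

Let metricC a b : e a b = e b a. Proof. by case: he. Qed.
Let metricT a b c : e a c <= e a b + e b c. Proof. by case: he. Qed.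

(** Points picked in growing finite stages form a Cauchy sequence by fineness, and closedness keeps
    the limit in every member of the branch. *)
Lemma complete_closed U : (forall n m, metric_open e (~` U n m)) ->
  fine_covers e U -> complete_covers U.
Proof.
move=> clU fU x hx.
have /choice[s hs] n := fU n.+1%:R^-1 (ltac:(by rewrite invr_gt0)) x.
(* The lists [s k] with k <= n make the points Cauchy; the indices 0, ..., n put [a n] in the first
   n + 1 members. *)
pose S n := flatten [seq s k | k <- iota 0 n.+1] ++ iota 0 n.+1.
have /choice[a ha] n := hx (S n).
have as_ n m : (n <= m)%N -> meets_along U x (s n) (a m).
  move=> nm k ks; apply: ha; rewrite mem_cat; apply/orP; left.
  by apply/flattenP; exists (s n) => //; apply/map_f; rewrite mem_iota.
have aU k n : (k <= n)%N -> U k (x k) (a n).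
  by move=> kn; apply: ha; rewrite mem_cat mem_iota /= add0n ltnS kn orbT.
have [|l hl] := hcompl (u := a).
  move=> r /(divSn_lt 1)[n]; rewrite mul1r => nr.
  exists n => m m' nm nm'; apply: lt_trans nr.
  by apply: hs; exact: as_.
exists l => k; apply: contrapT => Ukl.
have [r [r0 hr]] := clU k (x k) l Ukl.
have [N hN] := hl r r0.
apply: (hr (a (maxn N k))); last exact/aU/leq_maxr.
by rewrite /= metricC; apply: hN; exact: leq_maxl.
Qed.

Variable d : nat -> T.
Hypothesis hd : forall a r, 0 < r -> exists n, e a (d n) < r.

(* Closed balls, so that the limit of a Cauchy branch stays in them. *)
Definition cball n m : set T := [set a | e a (d m) <= n.+1%:R^-1].

Lemma cball_cover n a : exists m, cball n m a.
Proof.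
have n0 : 0 < n.+1%:R^-1 :> R by rewrite invr_gt0.
by have [m /ltW] := hd a n0; exists m.
Qed.

Lemma cball_diam n m a b : cball n m a -> cball n m b -> e a b <= 2 / n.+1%:R.
Proof.
rewrite /cball /= => ha hb; have := metricT a (d m) b.
rewrite (metricC (d m)); move: ha hb; set q := _^-1; lra.
Qed.

Lemma cball_closed n m : metric_open e (~` cball n m).
Proof.
move=> a /= /negP; rewrite -ltNge => na.
exists (e a (d m) - n.+1%:R^-1); split; first by rewrite subr_gt0.
move=> b /= ab; apply/negP; rewrite -ltNge.
by move: na ab (metricT a b (d m)); set q := _^-1; lra.
Qed.

Definition sieve A U := [/\ core U = A, complete_covers U & fine_covers e U].

Lemma sieve_closed F : metric_open e (~` F) -> exists U, sieve F U.
Proof.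
move=> oF; exists (fun n m => F `&` cball n m).
have fn : fine_covers e (fun n m => F `&` cball n m).
  move=> r /(divSn_lt 2)[n nr] x; exists [:: n] => a b ha hb.
  have [_ an] := ha n (mem_head _ _); have [_ bn] := hb n (mem_head _ _).
  apply: le_lt_trans nr; exact: cball_diam an bn.
split => //.
  apply/seteqP; split => [a /(_ 0%N)[m []]//|a Fa n].
  by have [m] := cball_cover n a; exists m.
apply: complete_closed => // n m; rewrite setCI => a [Fa|ba].
  by have [r [r0 hr]] := oF a Fa; exists r; split=> // b /hr; left.
by have [r [r0 hr]] := cball_closed ba; exists r; split=> // b /hr; right.
Qed.

(** An open set is the union of the closed balls it contains, so stage 0 selects such a ball; its
    members are closed, being closed balls or empty. *)
Lemma sieve_open O : metric_open e O -> exists U, sieve O U.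
Proof.
move=> oO.
pose U n m : set T := if n is k.+1 then cball k m
  else [set a | cball (unpair m).1 (unpair m).2 a /\
    cball (unpair m).1 (unpair m).2 `<=` O].
have fn : fine_covers e U.
  move=> r /(divSn_lt 2)[n nr] x; exists [:: n.+1] => a b ha hb.
  have an := ha n.+1 (mem_head _ _); have bn := hb n.+1 (mem_head _ _).
  apply: le_lt_trans nr; exact: cball_diam an bn.
exists U; split => //.
  apply/seteqP; split => [a /(_ 0%N)[m [am +]]|a Oa [|n]]; first exact.
    have [r [r0 hr]] := oO a Oa; have [n nr] := divSn_lt 2 r0.
    have [m am] := cball_cover n a.
    exists (pickle (n, m)); rewrite /= unpairK /=; split => // b bm.
    by apply: hr; apply: le_lt_trans nr; exact: cball_diam am bm.
  by have [m] := cball_cover n a; exists m.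
apply: complete_closed => // -[|n] m; last exact: cball_closed.
move=> a /= ha.
have [sO|sO] := pselect (cball (unpair m).1 (unpair m).2 `<=` O); last first.
  by exists 1; split => // b _ [_].
have /cball_closed[r [r0 hr]] : ~ cball (unpair m).1 (unpair m).2 a.
  by move=> ?; apply: ha.
by exists r; split => // b /hr /= nb [].
Qed.

Lemma sieve_bigcap (A : nat -> set T) : (forall i, exists U, sieve (A i) U) ->
  exists U, sieve (\bigcap_i A i) U.
Proof.
move=> /choice[U hU]; exists (join_covers U); split.
- by rewrite core_join; apply: eq_bigcapr => i _; case: (hU i).
- by apply: (complete_join he) => i; case: (hU i).
- by move=> r r0; apply: (@fine_join _ _ _ 0%N); case: (hU 0%N) => _ _; exact.
Qed.

Lemma sieve_setT : exists U, sieve setT U.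
Proof. by apply: sieve_open => a _; exists 1; split. Qed.

(** The finite difference is written as a countable intersection, padded with [A i], to fit
    [sieve_bigcap]. *)
Lemma sieve_seqDU (A : nat -> set T) i :
  (forall i, exists U, sieve (A i) U) -> (forall i, exists U, sieve (~` A i) U) ->
  exists U, sieve (seqDU A i) U.
Proof.
move=> hA hAC.
rewrite (_ : seqDU A i = \bigcap_k (if (k < i)%N then ~` A k else A i)).
  by apply: sieve_bigcap => k; case: ifP.
apply/seteqP; split => [a [Aa na] k _|a ha].
  by case: ifPn => // ki Ak; apply: na; rewrite -bigcup_mkord; exists k.
split; first by have := ha i Logic.I; rewrite ltnn.
by rewrite -bigcup_mkord => -[k /= ki]; have := ha k Logic.I; rewrite ki.
Qed.

(** Complements are carried along because a union must first be made disjoint, which takes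
    differences. *)
Lemma sieve_borel A : <<s metric_open e >> A -> exists U, sieve A U.
Proof.
move=> hA.
suff : [set B | (exists U, sieve B U) /\ (exists U, sieve (~` B) U)] A by case.
apply: smallest_sub hA; last first.
  by move=> O oO; split; [exact: sieve_open|apply: sieve_closed; rewrite setCK].
split.
- split; last by rewrite setC0; exact: sieve_setT.
  by apply: sieve_open => a.
- by move=> B [hB hBC]; rewrite setTD; split => //; rewrite setCK.
- move=> F hF; split; last first.
    by rewrite setC_bigcup; apply: sieve_bigcap => i; case: (hF i).
  rewrite seqDU_bigcup_eq.
  have /choice[U hU] : forall i, exists U, sieve (seqDU F i) U.
    by move=> i; apply: sieve_seqDU => j; case: (hF j).
  have tF := trivIset_seqDU F.
  exists (union_covers (seqDU F) U); split.
  + by apply: core_union => i; case: (hU i).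
  + by apply: complete_union => // i; case: (hU i).
  + by move=> r r0; apply: fine_union => // i; case: (hU i) => _ _; exact.
Qed.

End polish.
End covers.

(** * Separation of the images of disjoint measurable sets *)

Section separation.
Context {R : realType} {dX dY : measure_display}
  (X : measurableType dX) (Y : measurableType dY).
Variables (dist : X -> X -> R) (dist' : Y -> Y -> R).
Hypotheses (hm : is_metric dist) (hc : metric_complete dist)
  (hs : metric_separable dist) (hb : metric_borel dist).
Hypotheses (hm' : is_metric dist') (hs' : metric_separable dist')
  (hb' : metric_borel dist').

Definition separated (P Q : set Y) :=
  exists B, [/\ measurable B, P `<=` B & Q `<=` ~` B].

(** Read contrapositively: nonseparated unions contain a nonseparated pair of pieces, which allows
    the descent along branches. *)
Lemma separated_bigcup (P Q : nat -> set Y) :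
  (forall i j, separated (P i) (Q j)) ->
  separated (\bigcup_i P i) (\bigcup_j Q j).
Proof.
move=> PQ; have /choice[B' hB'] := fun p : nat * nat => PQ p.1 p.2.
pose B i j := B' (i, j); have hB i j := hB' (i, j).
exists (\bigcup_i \bigcap_j B i j); split.
- apply: bigcupT_measurable => i; apply: bigcapT_measurable => j.
  by case: (hB i j).
- by move=> y [i _ Py]; exists i => // j _; case: (hB i j) => _ + _; apply.
- move=> y [j _ Qy] [i _ /(_ j Logic.I)]; by case: (hB i j) => _ _ /(_ y Qy).
Qed.

Lemma dense_seq {T : Type} (e : T -> T -> R) (t0 : T) : metric_separable e ->
  exists d : nat -> T, forall a r, 0 < r -> exists n, e a (d n) < r.
Proof.
move=> [D [/countable_injP[f fD] hD]].
have /choice[d hd] : forall n, exists y, forall z, D z -> f z = n -> y = z.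
  move=> n; have [[z [Dz fz]]|nz] := pselect (exists z, D z /\ f z = n).
    by exists z => z' Dz' fz'; apply: fD; rewrite ?inE // fz.
  by exists t0 => z Dz fz; exfalso; apply: nz; exists z.
exists d => a r /(hD a)[y Dy ay]; exists (f y).
by rewrite (hd _ y).
Qed.

Lemma ball_measurable (y : Y) r : measurable [set z | dist' y z < r].
Proof.
rewrite hb'; apply: sub_sigma_algebra => z /= yz.
exists (r - dist' y z); split; first by rewrite subr_gt0.
by move=> t /= zt; have [_ _ _ /(_ y z t)] := hm'; lra.
Qed.

Variable phi : X -> Y.
Hypothesis mphi : measurable_fun setT phi.

(* The sieve of [A] is joined with sieves refining preimages of small balls,
   so that it becomes fine for the pullback of [dist'] too. *)
Lemma sieve_pullback (A : set X) : measurable A ->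
  exists U, [/\ core U = A, complete_covers U &
    fine_covers (fun a b => dist' (phi a) (phi b)) U].
Proof.
move=> mA.
have [[x0 _]|X0] := pselect (exists x : X, True); last first.
  exists (fun _ _ => A); split.
  - by apply/seteqP; split => a; case: X0; exists a.
  - by move=> x /(_ [::])[a _]; case: X0; exists a.
  - by move=> r _ x; exists [::] => a; case: X0; exists a.
have [d hd] := dense_seq x0 hs; have [d' hd'] := dense_seq (phi x0) hs'.
have sieveP B : measurable B -> exists U, sieve dist B U.
  by rewrite hb; exact: (sieve_borel hm hc hd).
pose W n m := phi @^-1` [set z | dist' (d' m) z < n.+1%:R^-1].
have mW n m : measurable (W n m).
  by rewrite -[W n m]setTI; apply: mphi => //; exact: ball_measurable.
have WT n : \bigcup_m seqDU (W n) m = setT.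
  rewrite -seqDU_bigcup_eq; apply/seteqP; split => // a _.
  have [m am] := hd' (phi a) n.+1%:R^-1 ltac:(by rewrite invr_gt0).
  by exists m => //; rewrite /W /=; case: hm' => _ _ ->.
(* [V n] represents the whole space, cut at stage 0 into disjoint pieces whose images lie in balls
   of radius 1 / (n + 1). *)
have /choice[V hV] : forall n, exists V, [/\ core V = setT, complete_covers V,
    fine_covers dist V & fine_at (fun a b => dist' (phi a) (phi b)) (2 / n.+1%:R) V].
  move=> n.
  have /choice[U hU] : forall i, exists U, sieve dist (seqDU (W n) i) U.
    move=> i; apply: sieveP; apply: measurableD => //.
    by rewrite -bigcup_mkord; exact: bigcup_measurable.
  have tF := @trivIset_seqDU _ (W n).
  exists (union_covers (seqDU (W n)) U); split.
  - by rewrite core_union// => i; case: (hU i).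
  - by apply: complete_union => // i; case: (hU i).
  - by move=> r r0; apply: fine_union => // i; case: (hU i) => _ _; exact.
  - move=> x; exists [:: 0%N] => a b ha hb0.
    have [+ _] := ha 0%N (mem_head _ _); have [+ _] := hb0 0%N (mem_head _ _).
    rewrite /W /=; case: hm' => _ _ dC dT.
    have := dT (phi a) (d' (x 0%N)) (phi b); rewrite (dC (phi a) (d' _)).
    by set q := _^-1; lra.
have [U [cU kU fU]] := sieveP A mA.
pose U' n := if n is m.+1 then V m else U.
exists (join_covers U'); split.
- rewrite core_join; apply/seteqP; split => [a /(_ 0%N Logic.I)|a Aa].
    by rewrite /= cU.
  by move=> -[|n] _ /=; rewrite ?cU //; have [->] := hV n.
- by apply: (complete_join hm) => -[|n] //=; case: (hV n).
- move=> r /(divSn_lt 2)[n nr] x.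
  have [|s hs0] := @fine_join _ _ (fun a b => dist' (phi a) (phi b))
    (2 / n.+1%:R) U' n.+1 _ x.
    by case: (hV n).
  by exists s => a b ha hb0; apply: lt_trans nr; exact: hs0.
Qed.

Hypothesis iphi : injective phi.

(* If the images were not separated, one could choose branches of the two sieves
   all of whose finite stages have nonseparated images; the limit points of the
   branches have distinct images, which small balls separate. *)
Lemma separated_image (A A' : set X) : measurable A -> measurable A' ->
  A `&` A' = set0 -> separated (phi @` A) (phi @` A').
Proof.
move=> mA mA' AA'; apply: contrapT => nsep.
have [U [cU kU fU]] := sieve_pullback mA.
have [U' [cU' kU' fU']] := sieve_pullback mA'.
pose NS P Q := ~ separated (phi @` P) (phi @` Q).
have step n P Q : P `<=` A -> Q `<=` A' -> NS P Q ->
    exists mm : nat * nat, NS (P `&` U n mm.1) (Q `&` U' n mm.2).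
  move=> PA QA ns; apply: contrapT => /forallNP h; apply: ns.
  have -> : phi @` P = \bigcup_i phi @` (P `&` U n i).
    rewrite -image_bigcup; congr image; rewrite -setI_bigcupr.
    apply/esym/setIidPl => a /PA; rewrite -cU => /(_ n)[m ?]; by exists m.
  have -> : phi @` Q = \bigcup_i phi @` (Q `&` U' n i).
    rewrite -image_bigcup; congr image; rewrite -setI_bigcupr.
    apply/esym/setIidPl => a /QA; rewrite -cU' => /(_ n)[m ?]; by exists m.
  by apply: separated_bigcup => i j; apply: contrapT; exact: (h (i, j)).
pose mm n (PQ : set X * set X) : nat * nat :=
  xget (0, 0)%N [set mm | NS (PQ.1 `&` U n mm.1) (PQ.2 `&` U' n mm.2)].
pose st := fix st n : set X * set X := if n is k.+1 then
  ((st k).1 `&` U k (mm k (st k)).1, (st k).2 `&` U' k (mm k (st k)).2)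
  else (A, A').
have hst n : [/\ (st n).1 `<=` A, (st n).2 `<=` A' & NS (st n).1 (st n).2].
  elim: n => [|n [hA hA' hNS]]; first by split.
  split.
  - by apply: subset_trans hA; exact: subIsetl.
  - by apply: subset_trans hA'; exact: subIsetl.
  - have [p hp] := step n _ _ hA hA' hNS.
    apply: (@xgetI _ (0, 0)%N [set mm | NS ((st n).1 `&` U n mm.1)
      ((st n).2 `&` U' n mm.2)] _ hp).
pose x n := (mm n (st n)).1; pose x' n := (mm n (st n)).2.
have st1 n : (st n).1 = A `&` [set a | forall k, (k < n)%N -> U k (x k) a].
  elim: n => [|n IH] /=; first by apply/esym/setIidPl.
  rewrite IH -setIA; congr (_ `&` _); apply/seteqP; split.
    by move=> a [h Ua] k; rewrite ltnS leq_eqVlt => /predU1P[->//|]; exact: h.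
  by move=> a h; split => [k kn|]; apply: h => //; exact: ltnW.
have st2 n : (st n).2 = A' `&` [set a | forall k, (k < n)%N -> U' k (x' k) a].
  elim: n => [|n IH] /=; first by apply/esym/setIidPl.
  rewrite IH -setIA; congr (_ `&` _); apply/seteqP; split.
    by move=> a [h Ua] k; rewrite ltnS leq_eqVlt => /predU1P[->//|]; exact: h.
  by move=> a h; split => [k kn|]; apply: h => //; exact: ltnW.
have below (s : seq nat) k : k \in s -> (k < (\max_(i <- s) i).+1)%N.
  by move=> ks; rewrite ltnS; exact: leq_bigmax_seq.
have [a ha] : exists a, forall k, U k (x k) a.
  apply: kU => s; pose n := (\max_(i <- s) i).+1.
  have [|P0] := pselect ((st n).1 !=set0).
    by rewrite st1 => -[a [_ h]]; exists a => k /below; exact: h.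
  (* An empty stage would be separated from anything: by [set0] here, by [setT] for the other
     branch. *)
  exfalso; have [_ _ nS] := hst n; apply: nS; exists set0.
  split => //; last by rewrite setC0.
  by move=> y [a Pa _]; case: P0; exists a.
have [b hb0] : exists a, forall k, U' k (x' k) a.
  apply: kU' => s; pose n := (\max_(i <- s) i).+1.
  have [|P0] := pselect ((st n).2 !=set0).
    by rewrite st2 => -[a0 [_ h]]; exists a0 => k /below; exact: h.
  exfalso; have [_ _ nS] := hst n; apply: nS; exists setT; split => //.
  by move=> y [a0 Pa _]; case: P0; exists a0.
have Aa : A a by rewrite -cU => n; exists (x n).
have Ab : A' b by rewrite -cU' => n; exists (x' n).
have [d0 dE dC dT] := hm'.
have r0 : 0 < dist' (phi a) (phi b) / 2.
  rewrite divr_gt0// lt_def d0 andbT; apply/eqP => /dE/iphi ab.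
  suff : (A `&` A') a by rewrite AA'.
  by split => //; rewrite ab.
have [s hs0] := fU _ r0 x; have [s' hs0'] := fU' _ r0 x'.
(* A stage late enough to include both lists: the images of its two sets lie within half the
   distance of [phi a] and of [phi b]. *)
pose n := (\max_(i <- s ++ s') i).+1.
have [_ _ nS] := hst n; apply: nS.
exists [set z | dist' (phi a) z < dist' (phi a) (phi b) / 2]; split.
- exact: ball_measurable.
- move=> _ [a' + <-] /=; rewrite st1 => -[_ ha'].
  by apply: hs0 => k ks //; apply/ha'/below; rewrite mem_cat ks.
- move=> _ [b' + <-] /=; rewrite st2 => -[_ hb'0].
  have : dist' (phi b) (phi b') < dist' (phi a) (phi b) / 2.
    by apply: hs0' => k ks //; apply/hb'0/below; rewrite mem_cat ks orbT.
  by have := dT (phi a) (phi b') (phi b); rewrite (dC (phi b') (phi b)); lra.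
Qed.

End separation.

Lemma measurable_image_bijective {R : realType} dX dY
  (X : measurableType dX) (Y : measurableType dY)
  (dist : X -> X -> R) (dist' : Y -> Y -> R) (phi : X -> Y) (A : set X) :
  is_metric dist -> metric_complete dist -> metric_separable dist ->
  metric_borel dist -> is_metric dist' -> metric_separable dist' ->
  metric_borel dist' ->
  measurable_fun setT phi -> bijective phi -> measurable A ->
  measurable (phi @` A).
Proof.
move=> hm hc hs hb hm' hs' hb' mphi bphi mA.
have [B [mB AB ACB]] := separated_image hm hc hs hb hm' hs' hb' mphi (bij_inj bphi)
  mA (measurableC mA) (setICr A).
suff -> : phi @` A = B by [].
apply/seteqP; split => // y By; have [g gK Kg] := bphi.
exists (g y); last exact: Kg.
by apply: contrapT => nA; apply: (ACB y) => //; exists (g y).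
Qed.

(** * Measurability of zeta *)

Lemma measurable_fun_cover d1 d2 (T1 : measurableType d1) (T2 : measurableType d2)
    (I : countType) (E : I -> set T1) (v : I -> T1 -> T2) (f : T1 -> T2) :
  (forall i, measurable (E i)) -> (forall w, exists i, E i w) ->
  (forall i, measurable_fun (E i) (v i)) ->
  (forall i w, E i w -> f w = v i w) -> measurable_fun setT f.
Proof.
move=> mE ET mv fv _ Y mY; rewrite setTI.
rewrite (_ : f @^-1` Y = \bigcup_i (E i `&` v i @^-1` Y)).
  by apply: countable_bigcupT_measurable => // i; exact: mv.
apply/seteqP; split => [w /= Yw|w [i _ []] Ew /=]; last by rewrite (fv i).
by have [i Ew] := ET w; exists i => //; split => //=; rewrite -(fv i).
Qed.

(** * Evaluation of random Lipschitz maps *)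

Section evaluation.
Context {R : realType}.

Lemma lipconst_ub (f : R -> R) : lipschitzR f ->
  forall x y, `|f y - f x| <= lipconst f * `|x - y|.
Proof.
move=> [L hL] x y; have [->|xy] := eqVneq x y.
  by rewrite !subrr normr0 mulr0.
have d0 : 0 < `|x - y| by rewrite normr_gt0 subr_eq0.
rewrite -ler_pdivrMr//; apply: ub_le_sup; last by exists x, y.
exists L => _ [x' [y' [xy' ->]]].
by rewrite ler_pdivrMr ?normr_gt0 ?subr_eq0.
Qed.

Lemma lipschitzRB (f g : R -> R) : lipschitzR f -> lipschitzR g ->
  lipschitzR (fun x => f x - g x).
Proof.
move=> [L hL] [M hM]; exists (L + M) => x y.
rewrite (_ : _ - _ - _ = (f y - f x) - (g y - g x)); last by lra.
by rewrite mulrDl; apply: le_trans (ler_normB _ _) _; exact: lerD.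
Qed.

Lemma lip_eval_dist (f g : Lip R) x :
  `|f x - g x| <= (1 + `|x|) * lipdist f g.
Proof.
have := lipconst_ub (lipschitzRB (lip_prop f) (lip_prop g)) 0 x.
rewrite /lipdist; set l := lipconst _; set h := fun x => f x - g x.
rewrite -/(h x) -/(h 0) sub0r normrN => hl.
have l0 : 0 <= l.
  have := lipconst_ub (lipschitzRB (lip_prop f) (lip_prop g)) 0 1.
  by rewrite -/l sub0r normrN normr1 mulr1; apply: le_trans.
have : `|h x| <= `|h 0| + `|h x - h 0|.
  by rewrite -{1}(subrK (h 0) (h x)) addrC; exact: ler_normD.
have := mulr_ge0 (normr_ge0 x) (normr_ge0 (h 0)).
by rewrite mulrDl mulrDr mul1r; move: hl; rewrite (mulrC l); lra.
Qed.

Lemma measurable_lip_eval x : measurable_fun setT (fun f : Gsp R => lip_fun f x).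
Proof.
apply: (measurability _ (RGenOInfty.measurableE R)) => _ [_ [a ->] <-].
rewrite setTI; apply: sub_sigma_algebra => f /=.
rewrite in_itv /= andbT => af.
have x1 : 0 < 1 + `|x| by rewrite ltr_pwDl.
exists ((f x - a) / (1 + `|x|)); split; first by rewrite divr_gt0// subr_gt0.
move=> g /=; rewrite ltr_pdivlMr// mulrC in_itv /= andbT => fg.
have := le_lt_trans (lip_eval_dist f g x) fg.
by have := ler_norm (f x - g x); lra.
Qed.

(** The Lipschitz norm is not separable, so continuity of (f, x) -> f x does not settle joint
    measurability for the product sigma-algebra. Instead [h] is rounded down to a grid, which leaves
    evaluations at countably many fixed points, and each [g w] is continuous. *)
Lemma measurable_lip_comp d (T : measurableType d) (g : T -> Gsp R) (h : T -> R) :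
  measurable_fun setT g -> measurable_fun setT h ->
  measurable_fun setT (fun w => lip_fun (g w) (h w)).
Proof.
move=> mg mh.
pose q n w : R := (Num.floor (h w * n.+1%:R))%:~R / n.+1%:R.
apply: (@measurable_fun_cvg _ _ _ _ (fun n w => lip_fun (g w) (q n w))) => [n|w _].
  pose E (k : int) := h @^-1` `[k%:~R / n.+1%:R, (k + 1)%:~R / n.+1%:R[.
  apply: (@measurable_fun_cover _ _ _ _ _ E
      (fun k w => lip_fun (g w) (k%:~R / n.+1%:R))).
  - by move=> k; rewrite /E -[X in measurable X]setTI; apply: mh.
  - move=> w; exists (Num.floor (h w * n.+1%:R)); rewrite /E /= in_itv /=.
    by rewrite ler_pdivrMr// ltr_pdivlMr// floor_itv.
  - move=> k; apply: measurable_funTS.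
    exact: (measurableT_comp (measurable_lip_eval (k%:~R / n.+1%:R)) mg).
  - move=> k w; rewrite /E /= in_itv /= ler_pdivrMr// ltr_pdivlMr// -floor_eq.
    by rewrite /q => /eqP ->.
have qh n : `|h w - q n w| <= n.+1%:R^-1.
  have /andP[] := floor_itv (h w * n.+1%:R).
  rewrite -ler_pdivrMr// -ltr_pdivlMr// -/(q n w) intrD mulrDl -/(q n w) mul1r.
  by move=> h1 h2; rewrite ler_norml; apply/andP; split;
    move: h1 h2; set r := n.+1%:R^-1; lra.
have [L hL] := lip_prop (g w).
apply/cvgrPdist_lt => e e0; near=> n.
apply: le_lt_trans (hL _ _) _; rewrite distrC.
have L1 : L <= `|L| + 1 by rewrite (le_trans (ler_norm _))// lerDl.
apply: (@le_lt_trans _ _ ((`|L| + 1) * n.+1%:R^-1)).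
  apply: le_trans (ler_wpM2r (normr_ge0 _) L1) _.
  by apply: ler_wpM2l => //; rewrite addr_ge0.
rewrite mulrC ltr_pdivrMl// mulrC -ltr_pdivrMl// mulrC.
near: n; exists (Num.truncn ((`|L| + 1) / e)) => // n /= hn.
by apply: lt_le_trans (truncnS_gt _) _; rewrite ler_nat.
Unshelve. all: by end_near. Qed.

End evaluation.

Lemma count_eq1P {dO dS} {O : measurableType dO} {S : measurableType dS}
    (Pts : O -> set S) B w :
  count_eq Pts B 1 w <-> exists p, Pts w `&` B = [set p].
Proof.
split=> [[e [_ eB]]|[p pB]].
  exists (e ord0); rewrite eB; apply/seteqP; split => [_ [i _ <-]|_ ->].
    by rewrite (ord1 i).
  by exists ord0.
exists (fun=> p); split => [i j _|]; first by rewrite (ord1 i) (ord1 j).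
rewrite pB; apply/seteqP; split => [_ ->|_ [i _ <-]] //.
by exists ord0.
Qed.

Lemma count_eq0P {dO dS} {O : measurableType dO} {S : measurableType dS}
    (Pts : O -> set S) B w :
  count_eq Pts B 0 w <-> Pts w `&` B = set0.
Proof.
split=> [[e [_ ->]]|PB0]; first by apply/seteqP; split => // p [[]].
exists (fun i : 'I_0 => False_rect S (notF (ltn_ord i))).
by split => [[]//|]; rewrite PB0; apply/seteqP; split => // p [[]].
Qed.

Lemma exists_common_pos {R : realType} (T : eqType) (s : seq T) (Q : T -> R -> Prop) :
  (forall p d d', d' <= d -> Q p d -> Q p d') ->
  (forall p, p \in s -> exists2 d, 0 < d & Q p d) ->
  exists2 d, 0 < d & forall p, p \in s -> Q p d.
Proof.
move=> mQ; elim: s => [|p s IH] hs; first by exists 1.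
have [d d0 hd] := IH (fun q qs => hs q (mem_behead (s := p :: s) qs)).
have [d' d'0 hd'] := hs p (mem_head _ _).
exists (Num.min d d') => [|q]; first by rewrite lt_min d0.
rewrite inE => /predU1P[->|qs].
  by apply: mQ hd'; rewrite ge_min lexx orbT.
by apply: mQ (hd q qs); rewrite ge_min lexx.
Qed.

Lemma lipschitzR_id {R : realType} : lipschitzR (@id R).
Proof. by exists 1 => x y; rewrite mul1r distrC. Qed.

Section zeta_measurable.
Context {R : realType} {dX} (X : measurableType dX) {dO} (O : measurableType dO).
Variables (z0 : R) (Pts : O -> set (R * (X * Gsp R))) (A : set X).
Hypothesis mA : measurable A.

Let S := (R * (X * Gsp R))%type.

Definition slab (t : R) : set S := [set p | 0 <= p.1 <= t /\ A p.2.1].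

(** Restricted to subsets of slabs, which have finite intensity when [mu A] is finite: the identity
    process on [config] then satisfies it. *)
Hypothesis mcount : forall (B : set S) k, measurable B ->
  (exists t, B `<=` slab t) -> measurable (count_eq Pts B k).

Let precedes : rel S := fun p q => p.1 < q.1.

Definition listing (t : R) (w : O) (s : seq S) :=
  sorted precedes s /\ (forall p, window Pts A t w p <-> p \in s).

Let compose (z : R) (s : seq S) : R :=
  foldr (fun p acc => lip_fun p.2.2 acc) z s.

(** A strictly increasing list is determined by its members, so the choice made by [xget] is
    immaterial. *)
Lemma zeta_listing t w s : listing t w s ->
  zeta_t z0 Pts A t w = compose z0 s.
Proof.
move=> [ss ws]; rewrite /zeta_t.
case: xgetP => [z _ [s' [ss' ws' ->]]|/(_ (compose z0 s))]; last first.
  by case; exists s; split.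
congr foldr; apply: (irr_sorted_eq (leT := precedes)) => //.
- by move=> q p r; exact: lt_trans.
- by move=> p; exact: ltxx.
- by move=> p; apply/idP/idP => [/ws'/ws|/ws/ws'].
Qed.

Lemma zeta_nolisting t w : (forall s, ~ listing t w s) ->
  zeta_t z0 Pts A t w = z0.
Proof.
move=> nl; rewrite /zeta_t; case: xgetP => // z _ [s [ss ws _]].
by case: (nl s); split.
Qed.

(* When all the time cells of width 1 / (n + 1) are occupied at most once, the
   composition runs through the cells in order, with the identity for an empty
   cell: its factors are then measurable. *)
Definition cell t n j : set S :=
  slab t `&` [set p | j%:R / n.+1%:R <= p.1 < j.+1%:R / n.+1%:R].

Lemma measurable_slab t : measurable (slab t).
Proof.
rewrite (_ : slab t = `[0, t]%classic `*` (A `*` setT)).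
  by apply: measurableX => //; exact: measurableX.
apply/seteqP; split => p /=; rewrite in_itv /=; first by case.
by move=> [? []].
Qed.

Lemma measurable_cell t n j : measurable (cell t n j).
Proof.
apply: measurableI; first exact: measurable_slab.
rewrite -[X in measurable X]setTI.
have mt : measurable (`[j%:R / n.+1%:R, j.+1%:R / n.+1%:R[ : set R).
  by exact: measurable_itv.
exact: (@measurable_fst _ _ R (X * Gsp R)%type measurableT _ mt).
Qed.

Let lip_id : Gsp R := MkLip lipschitzR_id.

Definition cell_map t n j (w : O) : Gsp R :=
  xget lip_id [set f | exists p : S, Pts w `&` cell t n j = [set p] /\ p.2.2 = f].

Lemma cell_map1 t n j w p : Pts w `&` cell t n j = [set p] ->
  cell_map t n j w = p.2.2.
Proof.
move=> wp; rewrite /cell_map.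
case: xgetP => [f _ [q []]|/(_ p.2.2)]; last by case; exists p.
by rewrite wp => /seteqP[/(_ p erefl) -> _] ->.
Qed.

Lemma cell_map0 t n j w : ~ count_eq Pts (cell t n j) 1 w ->
  cell_map t n j w = lip_id.
Proof.
move=> n1; rewrite /cell_map; case: xgetP => // f _ [p [wp _]].
by case: n1; apply/count_eq1P; exists p.
Qed.

(** When a cell holds exactly one point, its mark lies in [Y] iff the part of the cell with marks in
    [Y] also holds exactly one point; so counts determine the event. *)
Lemma measurable_cell_map t n j : measurable_fun setT (cell_map t n j).
Proof.
move=> _ Y mY; rewrite setTI; pose C := cell t n j.
have mC B : measurable B -> measurable (count_eq Pts (C `&` B) 1).
  move=> mB; apply: mcount; first by apply: measurableI => //; exact: measurable_cell.
  by exists t => p [[]].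
have mB : measurable [set p : S | Y p.2.2].
  by rewrite -[X in measurable X]setTI;
    apply: (measurableT_comp measurable_snd measurable_snd).
have mC1 : measurable (count_eq Pts C 1) by rewrite -[C]setIT; exact: mC.
rewrite (_ : _ @^-1` Y =
  count_eq Pts C 1 `&` count_eq Pts (C `&` [set p : S | Y p.2.2]) 1 `|`
  ~` count_eq Pts C 1 `&` [set _ | Y lip_id]).
  apply: measurableU; first by apply: measurableI => //; exact: mC.
  apply: measurableI; first exact: measurableC.
  have [Yi|Yi] := pselect (Y lip_id).
    by rewrite (_ : [set _ | _] = setT)//; apply/seteqP; split.
  by rewrite (_ : [set _ | _] = set0)//; apply/seteqP; split.
apply/seteqP; split => w /=.
  have [C1|C1] := pselect (count_eq Pts C 1 w); last first.
    by rewrite cell_map0// => Yi; right.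
  have /count_eq1P[p wp] := C1; rewrite (cell_map1 wp) => Yp; left; split => //.
  apply/count_eq1P; exists p; rewrite setIA wp.
  by apply/seteqP; split => [q []|q ->].
move=> [[/count_eq1P[p wp] /count_eq1P[q]]|[C1 Yi]]; last by rewrite cell_map0.
rewrite setIA wp (cell_map1 wp) => /seteqP[_ /(_ q erefl)] [->].
by [].
Qed.

Definition sparse t n : set O :=
  [set w | forall j, count_eq Pts (cell t n j) 0 w \/ count_eq Pts (cell t n j) 1 w].

Lemma measurable_sparse t n : measurable (sparse t n).
Proof.
rewrite (_ : sparse t n = \bigcap_j
    (count_eq Pts (cell t n j) 0 `|` count_eq Pts (cell t n j) 1)).
  apply: bigcapT_measurable => j; apply: measurableU; apply: mcount;
    by [exact: measurable_cell|exists t => p []].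
by apply/seteqP; split => w h j; [move=> _; exact: h|exact: h].
Qed.

Definition cell_compose t n (z : R) (m : nat) (w : O) : R :=
  foldr (fun j acc => lip_fun (cell_map t n j w) acc) z (iota 0 m).

Lemma measurable_cell_compose t n m :
  measurable_fun setT (cell_compose t n z0 m).
Proof.
rewrite /cell_compose; elim: (iota 0 m) => [|j s IH] /=; first exact: measurable_cst.
by apply: measurable_lip_comp => //; exact: measurable_cell_map.
Qed.

(** Induction on the number of cells. The last clause needs every [z], since a new cell adds the
    innermost map, which acts on the starting value. *)
Lemma sparse_listing t n w m : sparse t n w ->
  exists s, [/\ sorted precedes s,
    forall p, p \in s <-> (window Pts A t w p /\ p.1 < m%:R / n.+1%:R) &
    forall z, compose z s = cell_compose t n z m w].
Proof.
move=> sp; elim: m => [|m [s [ss ws cs]]].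
  exists [::]; split => // p; split => //.
  by rewrite mul0r => -[[_ [/andP[+ _] _]]]; rewrite leNgt => /negP.
have cellE p : window Pts A t w p /\ p.1 < m.+1%:R / n.+1%:R <->
    (window Pts A t w p /\ p.1 < m%:R / n.+1%:R) \/ (Pts w `&` cell t n m) p.
  have mS : m%:R / n.+1%:R <= m.+1%:R / n.+1%:R :> R.
    by rewrite ler_pM2r ?invr_gt0// ler_nat.
  split=> [[[wp Ap] pm]|[[wp pm]|[wp [Ap]]]].
  - have [?|mp] := ltP p.1 (m%:R / n.+1%:R); [left|right] => //.
    by split => //; split => //=; rewrite mp.
  - by split => //; exact: lt_le_trans mS.
  - by move=> /andP[].
case: (sp m) => [/count_eq0P w0|/count_eq1P[q wq]].
  exists s; split => // [p|z].
    by rewrite ws cellE w0; split => [|[]//]; left.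
  rewrite cs /cell_compose -addn1 iotaD foldr_cat /= add0n cell_map0//.
  by move=> /count_eq1P[q]; rewrite w0 => /seteqP[_ /(_ q erefl)].
have qm : m%:R / n.+1%:R <= q.1.
  have : (Pts w `&` cell t n m) q by rewrite wq.
  by move=> [_ [_]] /andP[].
exists (rcons s q); split => [|p|z].
- case: s ss ws {cs} => // p0 s ss ws; rewrite /= rcons_path; apply/andP; split => //.
  by have /ws[_ lm] := mem_last p0 s; exact: lt_le_trans qm.
- rewrite mem_rcons inE cellE wq -ws; split => [/predU1P[->|]|[->|->]].
  + by right.
  + by left.
  + by rewrite orbT.
  + by rewrite eqxx.
- rewrite /compose foldr_rcons -/(compose _ s) cs.
  by rewrite /cell_compose -addn1 iotaD foldr_cat /= add0n (cell_map1 wq).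
Qed.

(** The successor makes the right end of the last cell strictly larger than [t], so a point at time
    [t] is included. *)
Let ncells (t : R) n := (Num.truncn (t * n.+1%:R)).+1.

Lemma zeta_sparse t n w : sparse t n w ->
  zeta_t z0 Pts A t w = cell_compose t n z0 (ncells t n) w.
Proof.
move=> /(sparse_listing (ncells t n))[s [ss ws <-]]; apply: zeta_listing.
split=> // p; rewrite ws; split => [wp|[]//]; split => //.
have [_ [/andP[_ pt] _]] := wp; apply: le_lt_trans pt _.
by rewrite ltr_pdivlMr//; exact: truncnS_gt.
Qed.

Lemma sorted_time_inj (s : seq S) p q : sorted precedes s ->
  p \in s -> q \in s -> p.1 = q.1 -> p = q.
Proof.
move=> ss ps qs; have [i il <-] := nthP p ps; have [j jl <-] := nthP p qs.
have tr : transitive precedes by move=> ? ? ?; exact: lt_trans.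
have lt_nth := sorted_ltn_nth tr p ss.
have [ij|ji|->//] := ltngtP i j => pq.
  by have := lt_nth i j il jl ij; rewrite /precedes pq ltxx.
by have := lt_nth j i jl il ji; rewrite /precedes pq ltxx.
Qed.

(** Finitely many distinct times have a positive minimal gap, and a cell narrower than the gap holds
    at most one point. *)
Lemma listing_sparse t w s : listing t w s -> exists n, sparse t n w.
Proof.
move=> [ss ws].
have [d d0 hd] : exists2 d : R, 0 < d &
    forall pq, pq \in [seq (p, q) | p <- s, q <- s] ->
    pq.1 <> pq.2 -> d <= `|pq.1.1 - pq.2.1|.
  apply: exists_common_pos => [pq d d' dd' h /h|_ /allpairsP[[p q] [/= ps qs ->]]].
    exact: le_trans.
  have [pq|pq] := pselect (p = q); first by exists 1.
  exists `|p.1 - q.1| => //; rewrite normr_gt0 subr_eq0; apply/eqP => pq1.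
  by apply: pq; exact: (sorted_time_inj ss).
have [n] := divSn_lt 1 d0; rewrite mul1r => nd.
exists n => j; have [[p pC]|C0] := pselect (Pts w `&` cell t n j !=set0); last first.
  by left; apply/count_eq0P/eqP/negPn/negP => /set0P.
right; apply/count_eq1P; exists p; apply/seteqP; split => [q qC|_ -> //].
apply: contrapT => /nesym pq.
have inS r : (Pts w `&` cell t n j) r -> r \in s.
  by move=> [wr [rs _]]; apply/ws; split.
have := hd (p, q) (allpairs_f _ (inS p pC) (inS q qC)) pq.
rewrite leNgt => /negP; apply; apply: lt_trans nd.
move: pC qC => [_ [_ +]] [_ [_]] /=.
rewrite -[j.+1%:R]natr1 mulrDl mul1r => /andP[h1 h2] /andP[h3 h4].
by rewrite ltr_norml; move: h1 h2 h3 h4; set r := n.+1%:R^-1; lra.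
Qed.

Lemma measurable_zeta_t t : measurable_fun setT (zeta_t z0 Pts A t).
Proof.
pose E (i : option nat) : set O :=
  if i is Some n then sparse t n else ~` \bigcup_n sparse t n.
apply: (@measurable_fun_cover _ _ _ _ _ E (fun i =>
    if i is Some n then cell_compose t n z0 (ncells t n) else cst z0)).
- case=> [n|] /=; first exact: measurable_sparse.
  by apply/measurableC/bigcupT_measurable => n; exact: measurable_sparse.
- move=> w; have [[n _ nw]|nw] := pselect ((\bigcup_n sparse t n) w).
    by exists (Some n).
  by exists None.
- case=> [n|]; apply: measurable_funTS; last exact: measurable_cst.
  exact: measurable_cell_compose.
- move=> [n|] w /=; first exact: zeta_sparse.
  move=> nw; apply: zeta_nolisting => s /listing_sparse[n ?].
  by apply: nw; exists n.
Qed.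

(** Contrapositively, once no listing exists none exists later, and [zeta_t] stays at [z0]. *)
Lemma listing_le t t' w s : t <= t' -> listing t' w s ->
  listing t w [seq p <- s | p.1 <= t].
Proof.
move=> tt' [ss ws]; split.
  by apply: sorted_filter => // ? ? ?; exact: lt_trans.
move=> p; rewrite mem_filter; split.
  move=> [wp [/andP[p0 pt] Ap]]; rewrite pt /=; apply/ws.
  by split => //; split => //; rewrite p0 /= (le_trans pt).
by move=> /andP[pt /ws[wp [/andP[p0 _] Ap]]]; split => //; split => //; rewrite p0.
Qed.

(* [zeta_t] is a right-continuous step function of [t], unless it is
   eventually equal to its default value [z0]. *)
Lemma zeta_rat w : exists T : R, forall t, T <= t ->
  exists q : rat, t <= ratr q /\ zeta_t z0 Pts A (ratr q) w = zeta_t z0 Pts A t w.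
Proof.
have [good|/existsNP[T nT]] := pselect (forall t, exists s, listing t w s).
  (* Listing up to [t + 1] shows the next point after [t]; the bound by 1 in the minimum below keeps
     [q] inside this listing. *)
  exists 0 => t _; have [s [ss ws]] := good (t + 1).
  have [d d0 hd] : exists2 d : R, 0 < d & forall p, p \in s -> t < p.1 -> t + d <= p.1.
    apply: (@exists_common_pos _ _ s (fun p d => t < p.1 -> t + d <= p.1)).
      by move=> p d d' dd' h /h; lra.
    move=> p _; have [tp|] := ltP t p.1; last by exists 1.
    by exists (p.1 - t); [lra|move=> _; lra].
  have tm : t < t + Num.min d 1 by rewrite ltrDl lt_min d0 ltr01.
  have [q] := rat_in_itvoo tm; rewrite in_itv /= => /andP[tq qt].
  exists q; split; first exact: ltW.
  suff wE : window Pts A (ratr q) w = window Pts A t w by rewrite /zeta_t wE.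
  have [qd q1] : ratr q < t + d /\ ratr q < t + 1.
    by split; apply: (lt_le_trans qt); rewrite lerD2l ge_min lexx ?orbT.
  apply/seteqP; split => p [wp [/andP[p0 pt] Ap]]; split => //; split => //.
    rewrite p0 /= leNgt; apply/negP => tp.
    have ps : p \in s by apply/ws; split => //; split => //; rewrite p0 /=; lra.
    by have := hd p ps tp; lra.
  by rewrite p0 /= (le_trans pt)// ltW.
have bad t : T <= t -> zeta_t z0 Pts A t w = z0.
  move=> Tt; apply: zeta_nolisting => s /(listing_le Tt) hs.
  by apply: nT; eexists; exact: hs.
exists T => t Tt.
have t1 : t < t + 1 by rewrite ltrDl.
have [q] := rat_in_itvoo t1.
rewrite in_itv /= => /andP[tq _]; exists q.
by rewrite !bad// ?(le_trans Tt)// ltW.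
Qed.

(* A Cauchy criterion over rational times, hence a countable one. *)
Let cvg_set : set O := \bigcap_k \bigcup_N \bigcap_(q : rat)
  [set w | N%:R <= ratr q :> R ->
     `|zeta_t z0 Pts A (ratr q) w - zeta_t z0 Pts A N%:R w| <= k.+1%:R^-1].

Lemma cvg_setP w : cvg_set w <-> cvg (zeta_t z0 Pts A t w @[t --> +oo]).
Proof.
pose u t := zeta_t z0 Pts A t w.
split=> [Cw|/cvg_ex[/= l ul] k _].
  apply/cauchy_cvgP/cauchy_exP => e e0.
  have [k] := divSn_lt 1 e0; rewrite mul1r => ke.
  have [N _ hN] := Cw k Logic.I.
  have [T hT] := zeta_rat w.
  exists (u N%:R); change (\forall t \near +oo, ball (u N%:R) e (u t)); near=> t.
  (* The value at a real time is also taken at a later rational time, to which the countable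
     criterion applies. *)
  have [|q [tq uq]] := hT t.
    by near: t; apply: nbhs_pinfty_ge; rewrite num_real.
  rewrite -ball_normE /= distrC; apply: le_lt_trans ke.
  rewrite /u -uq; apply: (hN q Logic.I); apply: le_trans tq.
  by near: t; apply: nbhs_pinfty_ge; rewrite num_real.
have k2 : 0 < (k.+1%:R^-1 / 2 : R) by rewrite divr_gt0.
have /cvgrPdist_lt/(_ _ k2)[M [_ hM]] := ul.
pose N := (Num.truncn M).+1; have MN : M < N%:R by exact: truncnS_gt.
exists N => // q _ /= Nq.
have h1 := hM _ MN; have h2 := hM _ (lt_le_trans MN Nq).
have : `|u (ratr q) - u N%:R| <= `|l - u (ratr q)| + `|l - u N%:R|.
  by rewrite (distrC l (u (ratr q))) -(subrKA l); exact: ler_normD.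
by move: h1 h2; rewrite -/(u _) -/(u _); set r := _^-1; lra.
Unshelve. all: by end_near. Qed.

Lemma measurable_cvg_set : measurable cvg_set.
Proof.
apply: bigcapT_measurable => k; apply: bigcupT_measurable => N.
rewrite -[X in measurable X]setCK setC_bigcap; apply/measurableC.
apply: bigcupT_measurable_rat => q; apply: measurableC.
have [Nq|Nq] := pselect (N%:R <= ratr q :> R); last first.
  by rewrite (_ : [set w | _] = setT)//; apply/seteqP; split => // w _ /Nq.
pose h w := `|zeta_t z0 Pts A (ratr q) w - zeta_t z0 Pts A N%:R w|.
have mh : measurable_fun setT h.
  apply: measurableT_comp; first exact: normr_measurable.
  by apply: measurable_funB; exact: measurable_zeta_t.
rewrite (_ : [set w | _] = h @^-1` `]-oo, k.+1%:R^-1]).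
  by rewrite -[X in measurable X]setTI; apply: mh.
by apply/seteqP; split => w /=; rewrite in_itv /=; [exact|move=> + _].
Qed.

(** On [cvg_set] the limit is taken along the integers; elsewhere [lim] returns the constant
    [point]. *)
Lemma measurable_zeta : measurable_fun setT (zeta z0 Pts A).
Proof.
pose E b : set O := if b then cvg_set else ~` cvg_set.
apply: (@measurable_fun_cover _ _ _ _ bool E
    (fun b => if b then zeta z0 Pts A else cst point)).
- by case; [exact: measurable_cvg_set|apply/measurableC/measurable_cvg_set].
- by move=> w; have [?|?] := pselect (cvg_set w); [exists true|exists false].
- case; last exact: measurable_cst.
  apply: (@measurable_fun_cvg _ _ _ _ (fun n => zeta_t z0 Pts A n%:R)) => [n|w].
    by apply: measurable_funTS; exact: measurable_zeta_t.
  move=> /cvg_setP uw.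
  by apply: (cvg_comp _ _ cvgr_idn uw).
- case=> w //= nC; apply: dvgP => /cvg_setP; exact: nC.
Qed.

End zeta_measurable.

(** * Uniqueness of the law of a Poisson process *)

Section counts.
Context {S : choiceType}.
Implicit Types (w B : set S).

Definition has_count w B (k : nat) :=
  exists e : 'I_k -> S, injective e /\ w `&` B = range e.

(** An infinite set gets the value 0, whence the finiteness clause of [has_countP]. *)
Definition nb (B : set S) : nat := size (finmap.enum_fset (fset_set B)).

Lemma has_countP w B k :
  has_count w B k <-> finite_set (w `&` B) /\ nb (w `&` B) = k.
Proof.
split=> [[e [ie ->]]|[fin <-]].
  split; first exact: finite_image.
  apply: card_fset_set; apply: card_eq_trans (inj_card_eq (in2W ie)) _.
  by rewrite card_eq_sym; exact: card_II.
pose s : seq S := finmap.enum_fset (fset_set (w `&` B)).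
have us : uniq s by exact: finmap.fset_uniq.
have sE x : (x \in s) = (x \in w `&` B) by exact: in_fset_set.
exists (tnth (in_tuple s)); split; first exact/tuple_uniqP.
apply/seteqP; split => [x /mem_set|_ [i _ <-]].
  by rewrite -sE => /(tnthP (in_tuple s))[i ->]; exists i.
by apply: set_mem; rewrite -sE; exact: (mem_tnth i (in_tuple s)).
Qed.

Lemma has_count_inj w B k k' : has_count w B k -> has_count w B k' -> k = k'.
Proof. by move=> /has_countP[_ <-] /has_countP[_ <-]. Qed.

Lemma nb_bigU (I : finType) (p : pred I) (C : I -> set S) :
  (forall i, finite_set (C i)) -> (forall i j, i != j -> C i `&` C j = set0) ->
  nb (\big[setU/set0]_(i | p i) C i) = (\sum_(i | p i) nb (C i))%N.
Proof.
move=> fC dC.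
suff H r : uniq r -> nb (\big[setU/set0]_(i <- r | p i) C i) =
    (\sum_(i <- r | p i) nb (C i))%N by apply: H; exact: index_enum_uniq.
elim: r => [|i r IH] /=; first by rewrite !big_nil /nb fset_set0.
move=> /andP[ir ur]; rewrite !big_cons; case: ifP => [pi|_]; last exact: IH.
have fr : finite_set (\big[setU/set0]_(j <- r | p j) C j).
  by apply: big_ind => // A B fA fB; rewrite finite_setU.
rewrite -IH// /nb fset_setU// finmap.cardfsU.
rewrite -fset_setI// (_ : _ `&` _ = set0) ?fset_set0 ?finmap.cardfs0 ?subn0//.
rewrite big_distrr /= big_seq_cond big1 // => j /andP[jr _]; apply: dC.
by apply: contraNneq ir => ->.
Qed.

End counts.

Definition cylinder {S : choiceType} (I : Type) (B : I -> set S) (k : I -> nat) :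
    set (set S) :=
  [set w | forall i, has_count w (B i) (k i)].

Section atoms.
Context {S : choiceType} {I : finType} (B : I -> set S).

(** The clause [exists i, B i x] discards the complement of the union, whose intensity may be
    infinite; the atom of the empty index set is thus empty. *)
Definition atom (J : {set I}) : set S :=
  [set x | (exists i, B i x) /\ forall i, (i \in J) = `[< B i x >]].

Lemma atom_disjoint J J' : J != J' -> atom J `&` atom J' = set0.
Proof.
move=> JJ'; apply/seteqP; split => // x [[_ h] [_ h']]; case/negP: JJ'.
by apply/eqP/setP => i; rewrite h h'.
Qed.

Lemma atom_sub (J : {set I}) i : i \in J -> atom J `<=` B i.
Proof. by move=> iJ x [_ /(_ i)]; rewrite iJ => /esym/asboolP. Qed.

Lemma atom_set0 : atom finset.set0 = set0.
Proof.
apply/seteqP; split => // x [[i Bi] /(_ i)].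
by rewrite inE => /esym/asboolP.
Qed.

Lemma bigU_atom i : B i = \big[setU/set0]_(J : {set I} | i \in J) atom J.
Proof.
rewrite -bigcup_pred; apply/seteqP; split => [x Bx|x [J /= iJ]]; last exact: atom_sub.
have iJ : i \in [set i' | `[< B i' x >]]%SET by rewrite inE; apply/asboolP.
exists [set i' | `[< B i' x >]]%SET; first exact: iJ.
by split; [exists i|move=> i'; rewrite inE].
Qed.

(* Counts of overlapping sets are sums of counts of the disjoint atoms. *)
Lemma has_count_atoms w (k : I -> nat) :
  (forall i, has_count w (B i) (k i)) <->
  exists2 j : {set I} -> nat, (forall J, has_count w (atom J) (j J)) &
    (forall i, (\sum_(J : {set I} | i \in J) j J)%N = k i).
Proof.
have wB i : w `&` B i = \big[setU/set0]_(J : {set I} | i \in J) (w `&` atom J).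
  by rewrite [in LHS]bigU_atom big_distrr.
have dw J J' : J != J' -> (w `&` atom J) `&` (w `&` atom J') = set0.
  by move=> /atom_disjoint dJ; rewrite setIACA dJ setI0.
split=> [hk|[j hj jk] i].
  have fin J : finite_set (w `&` atom J).
    have [->|/set0Pn[i iJ]] := eqVneq J finset.set0.
      by rewrite atom_set0 setI0.
    have /has_countP[fi _] := hk i.
    by apply: sub_finite_set fi => x [wx /(atom_sub iJ)].
  exists (fun J => nb (w `&` atom J)) => [J|i]; first by apply/has_countP.
  by have /has_countP[_ <-] := hk i; rewrite wB nb_bigU.
have fin J : finite_set (w `&` atom J) by have /has_countP[] := hj J.
apply/has_countP; split.
  rewrite wB; apply: big_ind => // A A' fA fA'; by rewrite finite_setU.
rewrite wB nb_bigU// -jk; apply: eq_bigr => J _.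
by have /has_countP[] := hj J.
Qed.

End atoms.

Section law.
Context {R : realType} {dO dS} {O : measurableType dO} {S : measurableType dS}.
Variables (lambda : set S -> \bar R).

(** Sets may overlap and the index is any finite type, so that an intersection is again a cylinder,
    over the sum of the index types. *)
Definition finite_cylinders : set (set (set S)) :=
  [set E | exists (I : finType) (B : I -> set S) (k : I -> nat),
    (forall i, measurable (B i) /\ (lambda (B i) < +oo)%E) /\ E = cylinder B k].

(* Configurations, with the sigma-algebra generated by the counts of the sets of
   finite intensity: the Poisson property says nothing about the others. *)
Definition config := g_sigma_algebraType finite_cylinders.

Lemma setI_closed_finite_cylinders : setI_closed finite_cylinders.
Proof.
move=> _ _ [I [B [k [hB ->]]]] [I' [B' [k' [hB' ->]]]].
exists (I + I')%type, (fun i => match i with inl i => B i | inr i => B' i end),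
  (fun i => match i with inl i => k i | inr i => k' i end); split.
  by case.
apply/seteqP; split => [w [h h'] [i|i]//|w h]; split => i.
  exact: (h (inl i)).
exact: (h (inr i)).
Qed.

Lemma measurable_config (Pts : O -> set S) :
  (forall B k, measurable B -> measurable (count_eq Pts B k)) ->
  measurable_fun setT (Pts : O -> config).
Proof.
move=> mPts; apply: (@measurability _ _ O config setT Pts finite_cylinders) => //.
move=> _ [_ [I [B [k [hB ->]]]] <-].
rewrite setTI (_ : _ @^-1` _ = \bigcap_(i in [set: I]) count_eq Pts (B i) (k i)).
  apply: fin_bigcap_measurable => // i _; apply: mPts; by case: (hB i).
by apply/seteqP; split => w h i; [move=> _; exact: h|exact: h].
Qed.

Hypothesis lambda0 : (lambda set0 < +oo)%E.
Hypothesis le_lambda : forall B C, measurable B -> measurable C -> B `<=` C ->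
  (lambda B <= lambda C)%E.

Lemma poisson_fin_rectangle (P : probability O R) (Pts : O -> set S)
    (F : finType) (C : F -> set S) (j : F -> nat) :
  is_poisson_process P Pts lambda ->
  (forall f, measurable (C f)) -> (forall f, (lambda (C f) < +oo)%E) ->
  (forall f g, f != g -> C f `&` C g = set0) ->
  P (Pts @^-1` cylinder C j) =
    (\prod_(i < #|F|) poisson_weight (fine (lambda (C (enum_val i))))
      (j (enum_val i)))%:E.
Proof.
move=> [_ hP] mC fC dC.
rewrite -(hP _ (fun i : 'I_#|F| => C (enum_val i)) (fun i => j (enum_val i)))//.
  congr (P _); apply/seteqP; split => w h; first by move=> i _; exact: h.
  by move=> f; have := h (enum_rank f) Logic.I; rewrite /count_eq /= enum_rankK.
by move=> i i' ii'; apply: dC; apply: contra_neq ii'; exact: enum_val_inj.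
Qed.

Section uniqueness.
Variables (P P' : probability O R) (Pts Pts' : O -> set S).
Hypotheses (hP : is_poisson_process P Pts lambda)
  (hP' : is_poisson_process P' Pts' lambda).

(** The event splits into disjoint events that prescribe all atom counts; each has a product of
    Poisson weights as probability, which depends on [lambda] only. *)
Lemma poisson_cylinder_unique E : finite_cylinders E ->
  P (Pts @^-1` E) = P' (Pts' @^-1` E).
Proof.
move=> [I [B [k [hB ->]]]].
have mat J : measurable (atom B J).
  rewrite (_ : atom B J = \bigcup_(i in [set: I]) B i `&`
      \bigcap_(i in [set: I]) (if i \in J then B i else ~` B i)).
    apply: measurableI; first by apply: fin_bigcup_measurable => // i _; case: (hB i).
    apply: fin_bigcap_measurable => // i _.
    by case: ifP => _; [|apply: measurableC]; case: (hB i).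
  apply/seteqP; split => [x [[i Bi] h]|x [[i _ Bi] h]].
    by split; [exists i|move=> i' _; rewrite h; case: asboolP].
  split; first by exists i.
  move=> i'; have := h i' Logic.I; case: ifP => _ Bx; first by rewrite asboolT.
  by rewrite asboolF.
have fat J : (lambda (atom B J) < +oo)%E.
  have [->|/set0Pn[i iJ]] := eqVneq J finset.set0; first by rewrite atom_set0.
  have [mB fB] := hB i; apply: le_lt_trans fB; apply: le_lambda => //.
  exact: atom_sub.
(* A nonempty atom lies in some [B i], so its count is at most [k i]; the bound [K] makes the
   splitting finite. *)
pose K := (\sum_i k i)%N.
pose T := {ffun {set I} -> 'I_K.+1}.
pose D : set T := [set j : T |
  forall i, (\sum_(J : {set I} | i \in J) (j J : nat))%N = k i].
pose G (j : T) : set (set S) := cylinder (atom B) (fun J => j J : nat).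
have EG : cylinder B k = \bigcup_(j in D) G j.
  apply/seteqP; split => [w /has_count_atoms[j hj jk]|w [j jD hj]]; last first.
    by apply/has_count_atoms; exists (fun J => j J : nat).
  have jK J : (j J < K.+1)%N.
    rewrite ltnS; have [J0|/set0Pn[i iJ]] := eqVneq J finset.set0.
      have /has_countP[_ <-] := hj J.
      by rewrite J0 atom_set0 setI0 /nb fset_set0.
    apply: (@leq_trans (k i)); last by rewrite /K (bigD1 i)//= leq_addr.
    by rewrite -jk (bigD1 J)//= leq_addr.
  exists [ffun J => Ordinal (jK J)].
    by move=> i; rewrite -jk; apply: eq_bigr => J _; rewrite ffunE.
  by move=> J; rewrite ffunE; exact: hj.
have tG (Q : O -> set S) : trivIset D (fun j => Q @^-1` G j).
  move=> j j' _ _ [w [h h']]; apply/ffunP => J; apply/val_inj.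
  exact: has_count_inj (h J) (h' J).
have PG (P0 : probability O R) (Q : O -> set S) : is_poisson_process P0 Q lambda ->
    P0 (Q @^-1` cylinder B k) = (\sum_(j \in D) (\prod_(i < #|{set I}|)
      poisson_weight (fine (lambda (atom B (enum_val i)))) (j (enum_val i)))%:E)%E.
  move=> hQ; rewrite EG preimage_bigcup measure_fin_bigcup//.
  - apply: eq_fsbigr => j _; apply: poisson_fin_rectangle => //; exact: atom_disjoint.
  - exact: finite_finset.
  - move=> j _; case: hQ => mQ _.
    rewrite (_ : _ @^-1` _ = \bigcap_(J in [set: {set I}]) count_eq Q (atom B J) (j J)).
      by apply: fin_bigcap_measurable => // J _; exact: mQ.
    by apply/seteqP; split => w h J; [move=> _; exact: h|exact: h].
by rewrite (PG _ _ hP) (PG _ _ hP').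
Qed.

Lemma poisson_law_unique E : measurable (E : set config) ->
  P (Pts @^-1` E) = P' (Pts' @^-1` E).
Proof.
have mP : measurable_fun setT (Pts : O -> config) by apply: measurable_config; case: hP.
have mP' : measurable_fun setT (Pts' : O -> config) by apply: measurable_config; case: hP'.
have mpre (Q : O -> config) (F : set config) : measurable_fun setT Q -> measurable F ->
    measurable (Q @^-1` F).
  by move=> mQ mF; rewrite -[X in measurable X]setTI; exact: mQ.
apply: (@dynkin_induction _ config finite_cylinders
  (fun E => P (Pts @^-1` E) = P' (Pts' @^-1` E))) => //.
- exact: setI_closed_finite_cylinders.
- by rewrite !preimage_setT !probability_setT.
- exact: poisson_cylinder_unique.
- move=> F mF PF; have mF1 := mpre _ _ mP mF; have mF2 := mpre _ _ mP' mF.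
  transitivity (1 - P (Pts @^-1` F))%E; first exact: probability_setC.
  by rewrite PF; apply/esym; exact: probability_setC.
- move=> F mF tF PF.
  have mF1 n := mpre _ _ mP (mF n); have mF2 n := mpre _ _ mP' (mF n).
  have tpre (Q : O -> config) : trivIset setT (fun n => Q @^-1` F n).
    by move=> i j _ _ [w [Fi Fj]]; apply: tF => //; exists (Q w).
  rewrite !preimage_bigcup (measure_bigcup P)// (measure_bigcup P')//.
  by apply: eq_eseriesr => n _; exact: PF.
Qed.

End uniqueness.
End law.

(** * Invariance of the intensity *)

Section scaled_pushforward.
Local Open Scope ereal_scope.
Context {d1 d2} {T1 : measurableType d1} {T2 : measurableType d2} {R : realType}.
Variables (mu : {measure set T1 -> \bar R}) (f : T1 -> T2).
Hypothesis mf : measurable_fun setT f.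

Let image := pushforward mu f.

Let image0 : image set0 = 0. Proof. exact: measure0. Qed.

Let image_ge0 A : 0 <= image A. Proof. exact: measure_ge0. Qed.

Let image_sigma_additive : semi_sigma_additive image.
Proof. exact: measure_semi_sigma_additive. Qed.

HB.instance Definition _ := isMeasure.Build _ _ _ image
  image0 image_ge0 image_sigma_additive.

(** A bundled measure, to be compared with Lebesgue and product measures by their uniqueness
    theorems. *)
Definition scaled_pushforward (r : {nonneg R}) : {measure set T2 -> \bar R} :=
  mscale r image.

Lemma scaled_pushforwardE r A :
  scaled_pushforward r A = r%:num%:E * mu (f @^-1` A).
Proof. by []. Qed.

End scaled_pushforward.

Section intensity_invariance.
Local Open Scope ereal_scope.
Context {R : realType} {dX : measure_display} {X : measurableType dX}.

(* Null sets are handled by adding them to a set of positive finite measure,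
   and sets of infinite measure by exhaustion. *)
Lemma scaled_preimage (mu : {measure set X -> \bar R}) (phi : X -> X) (c : R) :
  sigma_finite setT mu -> measurable_fun setT phi -> (0 < c)%R ->
  (exists C, Bplus mu C) ->
  (forall A, Bplus mu A -> mu (phi @^-1` A) = c%:E * mu A) ->
  forall A, measurable A -> mu (phi @^-1` A) = c%:E * mu A.
Proof.
move=> smu mphi c0 [C [mC /andP[C0 Coo]]] hphi.
have mpre A : measurable A -> measurable (phi @^-1` A).
  by move=> mA; rewrite -[X in measurable X]setTI; exact: mphi.
have fin A : measurable A -> mu A < +oo -> mu (phi @^-1` A) = c%:E * mu A.
  move=> mA Aoo; have [A0|A0] := eqVneq (mu A) 0; last first.
    by apply: hphi; split => //; rewrite Aoo lt_def A0 measure_ge0.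
  rewrite A0 mule0.
  have CA : mu (C `\` A) = mu C.
    have CA0 : mu (C `&` A) = 0.
      apply/eqP; rewrite eq_le measure_ge0 andbT -A0.
      apply: le_measure; rewrite ?inE//.
      exact: measurableI.
    transitivity (mu (C `\` A) + mu (C `&` A)); first by rewrite CA0 adde0.
    by apply/esym; exact: measureDI.
  have mCA : measurable (C `\` A) by exact: measurableD.
  have dCA : (C `\` A) `&` A = set0 by rewrite setDE -setIA setICl setI0.
  have UE : mu ((C `\` A) `|` A) = mu C.
    transitivity (mu (C `\` A) + mu A); first exact: measureU.
    by rewrite CA A0 adde0.
  have h1 : mu (phi @^-1` ((C `\` A) `|` A)) = c%:E * mu C.
    by rewrite -UE; apply: hphi; split; [exact: measurableU|rewrite UE C0].
  have h2 : mu (phi @^-1` (C `\` A)) = c%:E * mu C.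
    by rewrite -CA; apply: hphi; split => //; rewrite CA C0.
  (* [C] minus [A] and its union with [A] both have measure [mu C]; their preimages differ by that
     of [A], and the finite term cancels. *)
  have h3 : c%:E * mu C + mu (phi @^-1` A) = c%:E * mu C.
    rewrite -[RHS]h1 -h2 preimage_setU.
    apply/esym; apply: measureU; [exact: mpre|exact: mpre|].
    by rewrite -preimage_setI dCA preimage_set0.
  have : c%:E * mu C \is a fin_num.
    by rewrite fin_numM// ge0_fin_numE// ltW.
  move=> cC; have := h3; rewrite addeC => /(congr1 (fun x => x - c%:E * mu C)).
  by rewrite addeK// subee.
move=> A mA.
have [F [FT Fnd hF]] := (sigma_finiteP setT mu).1 smu.
have mAF n : measurable (A `&` F n) by apply: measurableI => //; case: (hF n).
have AE : A = \bigcup_n (A `&` F n) by rewrite -setI_bigcupr -FT setIT.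
have nd : nondecreasing_seq (fun n => A `&` F n).
  by move=> m n mn; apply/subsetPset; apply: setIS; exact/subsetPset/Fnd.
have c1 : mu (A `&` F n) @[n --> \oo] --> mu A.
  by rewrite [in X in _ --> X]AE; apply: nondecreasing_cvg_mu => //; rewrite -AE.
have c2 : mu (phi @^-1` (A `&` F n)) @[n --> \oo] --> mu (phi @^-1` A).
  rewrite [in X in _ --> X]AE preimage_bigcup.
  apply: (nondecreasing_cvg_mu (F := fun n => phi @^-1` (A `&` F n))).
  - by move=> n; exact: mpre.
  - by apply: bigcupT_measurable => n; exact: mpre.
  - by move=> m n mn; apply/subsetPset => x; have /subsetPset := nd _ _ mn; exact.
apply: (cvg_unique _ c2) => //.
have -> : (fun n => mu (phi @^-1` (A `&` F n))) = (fun n => c%:E * mu (A `&` F n)).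
  apply/funext => n; apply: fin => //; have [mFn Fn] := hF n.
  by apply: le_lt_trans Fn; apply: le_measure; rewrite ?inE.
by apply: cvgeZl.
Qed.

Lemma lebesgue_measure_scale (c : R) (A : set R) : (0 < c)%R -> measurable A ->
  lebesgue_measure ((fun x => x / c)%R @^-1` A) = c%:E * lebesgue_measure A :> \bar R.
Proof.
move=> c0 mA.
have ci : (0 <= c^-1)%R by rewrite invr_ge0 ltW.
pose g : R -> measurableTypeR R := fun x => (x / c)%R.
have mg : measurable_fun setT g by exact: mulrr_measurable.
pose m := scaled_pushforward (@lebesgue_measure R) mg (NngNum ci).
have mE B : m B = c^-1%:E * lebesgue_measure (g @^-1` B) by [].
suff -> : lebesgue_measure A = m A.
  by rewrite mE muleA -EFinM divff ?gt_eqF// mul1e.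
apply: lebesgue_measure_unique => // _ [[a b] _ <-] /=; rewrite mE.
rewrite (_ : g @^-1` _ = `]a * c, b * c]%classic%R); last first.
  by apply/seteqP; split => x /=; rewrite !in_itv /= ltr_pdivlMr// ler_pdivrMr.
rewrite !lebesgue_measure_itv /= !lte_fin ltr_pM2r//.
case: ifPn => _; last by rewrite mule0.
by rewrite -!EFinB -EFinM -mulrBl mulrCA mulVf ?gt_eqF// mulr1.
Qed.

End intensity_invariance.

Section sigma_finite_pack.
Context {R : realType} {d : measure_display} {X : measurableType d}.
Variables (mu : {measure set X -> \bar R}) (hmu : sigma_finite setT mu).

Let mu0 : set X -> \bar R := mu.

HB.instance Definition _ := Measure.copy mu0 mu.

HB.instance Definition _ := Measure_isSigmaFinite.Build _ _ _ mu0 hmu.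

(** Turns the sigma-finiteness hypothesis into the structure over which the product measure results
    are stated. *)
Definition sigma_finite_pack : {sigma_finite_measure set X -> \bar R} := mu0.

End sigma_finite_pack.

Section product.
Local Open Scope ereal_scope.
Context {R : realType}.

(* [intensity] is a product over [measurableTypeR R], whose display is not that
   of [R] although the measurable sets are the same. *)
Definition leb_nneg : set (measurableTypeR R) -> \bar R :=
  mrestr (@lebesgue_measure R) (@measurable_Rpos R).

HB.instance Definition _ := Measure.copy leb_nneg
  (mrestr (@lebesgue_measure R) (@measurable_Rpos R)).

Let leb_nneg_sigma_finite : sigma_finite setT leb_nneg.
Proof.
have [F FT hF] := sigma_finiteT (@lebesgue_measure R).
exists F => // n; have [mF Foo] := hF n; split => //.
apply: le_lt_trans Foo; rewrite /leb_nneg /mrestr; apply: le_measure; rewrite ?inE//.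
by apply: measurableI => //; exact: measurable_Rpos.
Qed.

HB.instance Definition _ := Measure_isSigmaFinite.Build _ _ _ leb_nneg
  leb_nneg_sigma_finite.

Lemma leb_nneg_scale (c : R) (A : set (measurableTypeR R)) :
  (0 < c)%R -> measurable A ->
  leb_nneg ((fun x => x / c)%R @^-1` A) = c%:E * leb_nneg A.
Proof.
move=> c0 mA; rewrite /leb_nneg /mrestr -lebesgue_measure_scale//.
  congr lebesgue_measure; apply/seteqP; split => x; rewrite /= !in_itv /= !andbT.
    by move=> [Ax x0]; split => //; rewrite divr_ge0// ltW.
  by rewrite pmulr_lge0// invr_gt0.
by apply: measurableI => //; exact: measurable_Rpos.
Qed.

Context {dX : measure_display} {X : measurableType dX}.
Variables (mu : {sigma_finite_measure set X -> \bar R}) (nu : probability (Gsp R) R).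

Definition marked : set (X * Gsp R) -> \bar R := mu \x nu.

HB.instance Definition _ := Measure.copy marked (mu \x nu).

Lemma marked_setT A : measurable A -> marked (A `*` setT) = mu A.
Proof.
move=> mA; rewrite /marked product_measure1E//.
transitivity (mu A * 1); last exact: mule1.
by congr (_ * _); exact: probability_setT.
Qed.

Let marked_sigma_finite : sigma_finite setT marked.
Proof.
have [F FT hF] := sigma_finiteT mu.
exists (fun n => F n `*` setT) => [|n].
  by rewrite -setXTT FT setX_bigcupl.
have [mF Foo] := hF n; split; first exact: measurableX.
by rewrite marked_setT.
Qed.

HB.instance Definition _ := Measure_isSigmaFinite.Build _ _ _ marked
  marked_sigma_finite.

Lemma intensityE (A : set (measurableTypeR R)) C : measurable A -> measurable C ->
  intensity mu nu (A `*` C) = leb_nneg A * marked C.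
Proof. by move=> mA mC; exact: (product_measure1E leb_nneg marked mA mC). Qed.

Lemma intensity_set0 : intensity mu nu set0 = 0.
Proof. exact: (measure0 (leb_nneg \x marked)). Qed.

Lemma le_intensity B C : measurable B -> measurable C -> B `<=` C ->
  intensity mu nu B <= intensity mu nu C.
Proof.
by move=> mB mC BC; apply: (le_measure (leb_nneg \x marked)); rewrite ?inE.
Qed.

Lemma intensity_slab A t : measurable A -> mu A < +oo ->
  intensity mu nu (slab A t) < +oo.
Proof.
move=> mA Aoo.
rewrite (_ : slab A t = `[0%R, t]%classic `*` (A `*` setT)); last first.
  apply/seteqP; split => p /=; rewrite in_itv /=; first by case.
  by move=> [? []].
have mAT : measurable (A `*` [set: Gsp R]) by exact: measurableX.
rewrite intensityE// marked_setT//.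
apply: lte_mul_pinfty => //.
  rewrite ge0_fin_numE//.
  apply: (@le_lt_trans _ _ (lebesgue_measure `[0%R, t]%classic)).
    rewrite /leb_nneg /mrestr; apply: le_measure; rewrite ?inE//.
    by apply: measurableI => //; exact: measurable_Rpos.
  by rewrite lebesgue_measure_itv /=; case: ifP => _; rewrite // -EFinB ltry.
Qed.

Variables (g : X -> X) (c : R).
Hypotheses (mg : measurable_fun setT g) (c0 : (0 < c)%R).
Hypothesis hg : forall A, measurable A -> c%:E * mu (g @^-1` A) = mu A.

Definition rescale (p : R * (X * Gsp R)) : R * (X * Gsp R) :=
  (p.1 / c, (g p.2.1, p.2.2))%R.

Let relabel (q : X * Gsp R) : X * Gsp R := (g q.1, q.2).

Let measurable_relabel : measurable_fun setT relabel.
Proof.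
apply/measurable_fun_pairP; split.
  exact: (measurableT_comp mg measurable_fst).
exact: measurable_snd.
Qed.

Lemma measurable_rescale : measurable_fun setT rescale.
Proof.
apply/measurable_fun_pairP; split.
  exact: (measurableT_comp (mulrr_measurable _) measurable_fst).
exact: (measurableT_comp measurable_relabel measurable_snd).
Qed.

Let mpre {d} {T : measurableType d} (f : T -> T) (A : set T) :
  measurable_fun setT f -> measurable A -> measurable (f @^-1` A).
Proof. by move=> mf mA; rewrite -[X in measurable X]setTI; exact: mf. Qed.

Lemma relabel_scale C : measurable C ->
  c%:E * marked (relabel @^-1` C) = marked C.
Proof.
move=> mC; have c1 : (0 <= c)%R by exact: ltW.
pose m := scaled_pushforward marked measurable_relabel (NngNum c1).
transitivity (m C); first by [].
apply/esym; apply: (product_measure_unique (m' := m)) => // A B mA mB.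
rewrite /m scaled_pushforwardE/=.
transitivity (c%:E * marked ((g @^-1` A) `*` B)); first by [].
rewrite /marked product_measure1E//; last exact: mpre.
by rewrite muleA hg.
Qed.

(** By uniqueness of product measures rectangles suffice; there the factor c from the times cancels
    the 1 / c from the relabelling by [g]. *)
Lemma intensity_rescale B : measurable B ->
  intensity mu nu (rescale @^-1` B) = intensity mu nu B.
Proof.
move=> mB.
pose T := (measurableTypeR R * (X * Gsp R))%type; pose f : T -> T := rescale.
have mf : measurable_fun setT f by exact: measurable_rescale.
pose m := scaled_pushforward (leb_nneg \x marked) mf (NngNum (@ler01 R)).
transitivity (m B); first by rewrite /m scaled_pushforwardE/= mul1e.
transitivity ((leb_nneg \x marked) B); last by [].
apply/esym; apply: (product_measure_unique (m' := m)) => // A C mA mC.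
rewrite /m scaled_pushforwardE/= mul1e.
transitivity ((leb_nneg \x marked)
  (((fun x : measurableTypeR R => x / c)%R @^-1` A) `*` (relabel @^-1` C))); first by [].
rewrite product_measure1E//; [|exact: (mpre (mulrr_measurable _))|exact: mpre].
transitivity (c%:E * leb_nneg A * marked (relabel @^-1` C)).
  by congr (_ * _); exact: leb_nneg_scale.
by rewrite (muleC c%:E) -muleA relabel_scale.
Qed.

End product.

(** * Transport of zeta by rescaling *)

Lemma has_count_image {S : choiceType} (f : S -> S) (w B : set S) k :
  bijective f -> has_count (f @` w) B k <-> has_count w (f @^-1` B) k.
Proof.
move=> [f' fK Kf]; have fI := can_inj fK; have f'I := can_inj Kf.
split=> [[e [eI wB]]|[e [eI wB]]].
  exists (f' \o e); split; first exact: inj_comp.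
  apply/seteqP; split => [x [wx Bx]|_ [i _ <-]] /=.
    have : range e (f x) by rewrite -wB; split => //; exists x.
    by move=> [i _ ei]; exists i => //=; rewrite ei fK.
  have : range e (e i) by exists i.
  by rewrite -wB => -[[x wx <-] Bx]; rewrite fK.
exists (f \o e); split; first exact: inj_comp.
apply/seteqP; split => [_ [[x wx <-] Bx]|_ [i _ <-]] /=.
  have : range e x by rewrite -wB.
  by move=> [i _ ei]; exists i => //=; rewrite ei.
have : range e (e i) by exists i.
by rewrite -wB => -[wx Bx]; split => //; exists (e i).
Qed.

Section transport.
Context {R : realType} {dX dO} {X : measurableType dX} {O : measurableType dO}.
Variables (z0 : R) (Pts : O -> set (R * (X * Gsp R))).
Variables (phi g : X -> X) (c : R).
Hypotheses (gK : cancel phi g) (Kg : cancel g phi) (c0 : 0 < c).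

Let unscale (q : R * (X * Gsp R)) : R * (X * Gsp R) := (q.1 * c, (phi q.2.1, q.2.2)).

Lemma rescaleK : cancel (rescale g c) unscale.
Proof. by move=> [t [x f]]; rewrite /unscale /= divfK ?gt_eqF// Kg. Qed.

Lemma unscaleK : cancel unscale (rescale g c).
Proof. by move=> [t [x f]]; rewrite /rescale /= mulfK ?gt_eqF// gK. Qed.

Lemma bijective_rescale : bijective (rescale g c).
Proof. by exists unscale; [exact: rescaleK|exact: unscaleK]. Qed.

Let Pts' w := rescale g c @` Pts w.

Lemma window_rescale A t w p :
  window Pts' A (t / c) w (rescale g c p) <-> window Pts (phi @` A) t w p.
Proof.
have tc : (0 <= p.1 / c <= t / c) = (0 <= p.1 <= t).
  by rewrite pmulr_lge0 ?invr_gt0// ler_pM2r ?invr_gt0.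
split=> [[[q Pq /(can_inj rescaleK) qp] [pt Ap]]|[Pp [pt [x Ax xp]]]].
  split; first by rewrite -qp.
  by split; [exact: (etrans (esym tc) pt)|exists (g p.2.1) => //; rewrite Kg].
split; first by exists p.
by split; [exact: (etrans tc pt)|rewrite /= -xp gK].
Qed.

(** Mapping lists by [rescale] keeps the order and the marks, so the two sets given to [xget]
    coincide, even when both are empty. *)
Lemma zeta_t_rescale A t w :
  zeta_t z0 Pts (phi @` A) t w = zeta_t z0 Pts' A (t / c) w.
Proof.
have foldE s z : foldr (fun p acc => lip_fun p.2.2 acc) z (map (rescale g c) s) =
    foldr (fun p acc => lip_fun p.2.2 acc) z s.
  by elim: s => //= p s ->.
have sortE s : sorted (fun p q : R * (X * Gsp R) => p.1 < q.1) (map (rescale g c) s) =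
    sorted (fun p q : R * (X * Gsp R) => p.1 < q.1) s.
  rewrite sorted_map; apply: eq_sorted => p q /=.
  by rewrite ltr_pM2r ?invr_gt0.
have rI := can_inj rescaleK.
congr xget; apply/seteqP; split => z [s [ss ws ->]].
  exists (map (rescale g c) s); split; rewrite ?sortE ?foldE// => q.
  by rewrite -(unscaleK q) window_rescale ws mem_map.
have sE : s = map (rescale g c) (map unscale s).
  by rewrite -map_comp (eq_map unscaleK) map_id.
exists (map unscale s); split => [||].
- by rewrite -sortE -sE.
- by move=> p; rewrite -window_rescale ws {1}sE mem_map.
- by rewrite {1}sE foldE.
Qed.

(** The two image filters at infinity are equal, hence so are their [lim], whether or not they
    converge. *)
Lemma zeta_rescale A w : zeta z0 Pts (phi @` A) w = zeta z0 Pts' A w.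
Proof.
rewrite /zeta; congr (lim _); apply/seteqP; split => B /= [M [_ hM]].
  exists (M / c); split; first exact: num_real.
  move=> t Mt /=; have : B (zeta_t z0 Pts (phi @` A) (t * c) w).
    by apply: hM; rewrite -ltr_pdivrMr.
  by rewrite zeta_t_rescale mulfK ?gt_eqF.
exists (M * c); split; first exact: num_real.
by move=> t Mt /=; rewrite zeta_t_rescale; apply: hM; rewrite ltr_pdivlMr.
Qed.

End transport.

(** * Finite-dimensional laws under rescaling *)

Section invariance.
Context {R : realType} {dX dO} {X : measurableType dX} {O : measurableType dO}.
Variables (mu : {sigma_finite_measure set X -> \bar R}) (nu : probability (Gsp R) R).

Lemma measurable_fidi_zeta (z0 : R) n (A : 'I_n -> set X) (D : set (n.-tuple R)) :
  (forall i, Bplus mu (A i)) -> measurable D ->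
  measurable ([set w | D [tuple zeta z0 (fun w : config (intensity mu nu) => w)
    (A i) w | i < n]] : set (config (intensity mu nu))).
Proof.
move=> hA mD.
suff mz : measurable_fun setT (fun w : config (intensity mu nu) =>
    [tuple zeta z0 (fun w : config (intensity mu nu) => w) (A i) w | i < n]).
  by rewrite -[X in measurable X]setTI; exact: mz.
apply/measurable_fun_tnthP => i.
rewrite (_ : _ \o _ = zeta z0 (fun w : config (intensity mu nu) => w) (A i)); last first.
  by apply/funext => w; rewrite /= tnth_mktuple.
have [mA /andP[_ Aoo]] := hA i.
apply: measurable_zeta => // B k mB [t Bt].
(* The event for a single set is a cylinder over a one-point index. *)
apply: sub_sigma_algebra; exists unit, (fun=> B), (fun=> k); split.
  move=> _; split => //; apply: le_lt_trans (intensity_slab nu t mA Aoo).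
  by apply: le_intensity => //; exact: measurable_slab.
by apply/seteqP; split => w h; [move=> _; exact: h|exact: (h tt)].
Qed.

Lemma poisson_rescale (P : probability O R) Pts (g : X -> X) (c : R) :
  is_poisson_process P Pts (intensity mu nu) -> bijective (rescale g c) ->
  measurable_fun setT g -> 0 < c ->
  (forall A, measurable A -> (c%:E * mu (g @^-1` A) = mu A)%E) ->
  is_poisson_process P (fun w => rescale g c @` Pts w) (intensity mu nu).
Proof.
move=> [mPts hPts] br mg c0 hg.
have mr B : measurable B -> measurable (rescale g c @^-1` B).
  by move=> mB; rewrite -[X in measurable X]setTI; exact: measurable_rescale.
have countE B k : count_eq (fun w => rescale g c @` Pts w) B k =
    count_eq Pts (rescale g c @^-1` B) k.
  have h w := has_count_image (Pts w) B k br.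
  by apply/seteqP; split => w; [exact: (h w).1|exact: (h w).2].
have iE B mB := intensity_rescale (B := B) nu mg c0 hg mB.
split=> [B k mB|n B k mB fB dB]; first by rewrite countE; apply: mPts; exact: mr.
rewrite -(eq_bigcapr (fun i _ => esym (countE (B i) (k i)))).
rewrite hPts.
- by apply: congr1; apply: eq_bigr => i _; rewrite (iE (B i) (mB i)).
- by move=> i; exact: mr.
- by move=> i; rewrite (iE (B i) (mB i)).
- by move=> i j /dB ij; rewrite -preimage_setI ij preimage_set0.
Qed.

End invariance.

Theorem theorem3p2 (R : realType)
  (* the complete separable metric space X with a sigma-finite measure mu *)
  (dX : measure_display) (X : measurableType dX) (dist : X -> X -> R)
  (hmet : is_metric dist) (hcompl : metric_complete dist)
  (hsep : metric_separable dist) (hborel : metric_borel dist)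
  (mu : {measure set X -> \bar R}) (hmu : sigma_finite setT mu)
  (* the law nu of the random Lipschitz map f *)
  (nu : probability (Gsp R) R)
  (hL : (\int[nu]_f (lipconst f)%:E < +oo)%E)
  (hlog : (\int[nu]_f logL f < 0)%E)
  (z0 : R) (hz0 : (\int[nu]_f (`|f z0 - z0|)%:E < +oo)%E)
  (* the Poisson process on [0,oo) x X x G with intensity Leb (x) mu (x) nu *)
  (dO : measure_display) (O : measurableType dO) (P : probability O R)
  (Pts : O -> set (R * (X * Gsp R)))
  (hPts : is_poisson_process P Pts (intensity mu nu))
  (* the measurable bijection phi *)
  (phi : X -> X) (mphi : measurable_fun setT phi) (bphi : bijective phi)
  (c : R) (hc : 0 < c)
  (hphi : forall A, Bplus mu A -> mu (phi @^-1` A) = (c%:E * mu A)%E) :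
  forall (n : nat) (A : 'I_n -> set X), (forall i, Bplus mu (A i)) ->
  forall D : set (n.-tuple R), measurable D ->
    P [set w | D [tuple zeta z0 Pts (phi @` A i) w | i < n]] =
    P [set w | D [tuple zeta z0 Pts (A i) w | i < n]].
Proof.
(* For n = 0 all tuples are equal; otherwise [A ord0] is the set of positive finite measure that
   [scaled_preimage] asks for. *)
move=> [|n] A hA D mD.
  have E (s s' : 0.-tuple R) : s = s' by rewrite (tuple0 s) (tuple0 s').
  by congr (P _); apply/funext => w; congr (D _); exact: E.
have [g gK Kg] := bphi.
pose mu' := sigma_finite_pack hmu.
have gE B : g @^-1` B = phi @` B.
  apply/seteqP; split => [x Bx|_ [x Bx <-]]; last by rewrite /= gK.
  by exists (g x).
have mg : measurable_fun setT g.
  move=> _ B mB; rewrite setTI gE.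
  exact: (measurable_image_bijective hmet hcompl hsep hborel hmet hsep hborel).
have hg B : measurable B -> (c%:E * mu' (g @^-1` B) = mu' B)%E.
  move=> mB; rewrite -(scaled_preimage hmu mphi hc _ hphi).
  - by rewrite -comp_preimage (_ : g \o phi = id)//; apply/funext => x; exact: gK.
  - by exists (A ord0).
  - by rewrite -[X in measurable X]setTI; exact: mg.
pose Pts' w := rescale g c @` Pts w.
have hPts' : is_poisson_process P Pts' (intensity mu' nu).
  by apply: poisson_rescale => //; exact: bijective_rescale gK Kg hc.
pose E : set (config (intensity mu' nu)) :=
  [set w | D [tuple zeta z0 (fun w : config (intensity mu' nu) => w) (A i) w | i < n.+1]].
have mE : measurable E by exact: measurable_fidi_zeta.
have fin0 : (intensity mu' nu set0 < +oo)%E by rewrite intensity_set0.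
have law : P (Pts @^-1` E) = P (Pts' @^-1` E).
  exact: (poisson_law_unique fin0 (@le_intensity _ _ _ mu' nu) hPts hPts' mE).
transitivity (P (Pts' @^-1` E)); last exact: esym law.
congr (P _); apply/funext => w; congr (D _); apply: eq_mktuple => i.
exact: (zeta_rescale z0 Pts gK Kg hc).
Qed.
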